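(* There exists a sequence of positive numbers $\beta_1,\beta_2,\beta_3,\dots$ such that the following holds for every $d\ge1$ and every nonnegative integer-valued random variable $\Xi$. If for all $n$ large enough one of the following alternatives holds: \begin{itemize} \item $d=1$ and $\mathbf{P}[\Xi\ge n^2]\ge\beta_1 n^{-1}\log\log n$; \item $d=2$ and $\mathbf{P}[\Xi\ge n^2]\ge\beta_2 n^{-2}(\log n)^2$; \item $d\ge3$ and $\mathbf{P}[\Xi\ge n^2]\ge\beta_d n^{-2}\log n$; \end{itemize} then $\mathrm{FM}(\mathbb{Z}^d,\Xi)$ is recurrent.
   Context: $\mathbb{Z}^d$ denotes the graph with vertex set $\mathbb{Z}^d$ and edges between points at $\ell^1$-distance $1$, with root $\mathbf{0}$ the origin. Frog model $\mathrm{FM}(\mathcal{G},\Xi)$ with general lifetimes. Initially there is exactly one particle at each site (vertex) of $\mathcal{G}$; at time $0$ all particles are sleeping except the one at the root $\mathbf{0}$, which is active. Let $(\Xi^x)_{x\in\mathcal{G}}$ be i.i.d. random variables with the law of $\Xi$, and, independently of them, let $(S^x_n)_{n\ge0}$, $x\in\mathcal{G}$, be independent discrete-time simple random walks on $\mathcal{G}$, $S^x$ starting from $x$. If the particle of site $x$ is activated at time $T(x)$, it is active and located at $S^x_n$ at time $T(x)+n$ for $0\le n<\Xi^x$, and then disappears. When an active particle visits a site, the sleeping particle there (if any) becomes active. Formally, $t(x,y)=\min\{n<\Xi^x:S^x_n=y\}$ for $x\neq y$ ($\infty$ if there is no such $n$), and $T(x)=\inf\{t(x_0,x_1)+\dots+t(x_{m-1},x_m)\}$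 over all finite sequences $\mathbf{0}=x_0,x_1,\dots,x_m=x$, with $T(\mathbf{0})=0$; $T(x)=\infty$ means that $x$ is never visited by active particles. The root is hit infinitely often if there are infinitely many times at which some active particle is located at $\mathbf{0}$. The model is called recurrent if $\mathbf{P}[\mathbf{0}\text{ is hit infinitely often}]>0$, and transient otherwise. *)

(* Defs.v *)
From HB Require Import structures.
From mathcomp Require Import all_boot all_order all_algebra finmap.
From mathcomp Require Import all_classical all_reals all_analysis.

Set Implicit Arguments.
Unset Strict Implicit.
Unset Printing Implicit Defensive.

Import Order.TTheory GRing.Theory Num.Theory.
Import numFieldNormedType.Exports.

Local Open Scope classical_set_scope.
Local Open Scope ring_scope.

(* An alias of 'rV[int]_d, so that it can carry the discrete sigma-algebra. *)
Definition Zd (d : nat) : Type := 'rV[int]_d.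

HB.instance Definition _ (d : nat) := GRing.Zmodule.on (Zd d).
HB.instance Definition _ (d : nat) := Countable.on (Zd d).
HB.instance Definition _ (d : nat) := isPointed.Build (Zd d) 0.
HB.instance Definition _ (d : nat) :=
  @isMeasurable.Build default_measure_display (Zd d)
    discrete_measurable discrete_measurable0
    discrete_measurableC discrete_measurableU.

Definition Zd_adj (d : nat) : rel (Zd d) :=
  fun x y => (\sum_(i < d) `|x ord0 i - y ord0 i|)%N == 1%N.

Section Independence.
Context {R : realType} {disp : measure_display} {Omega : measurableType disp}.
Variable P : probability Omega R.
Local Open Scope ereal_scope.

Definition sigma_of {I : Type} {disp' : measure_display}
    {T : measurableType disp'} (X : I -> Omega -> T) : set_system Omega :=
  <<s \bigcup_(i in [set: I]) preimage_set_system [set: Omega] (X i) measurable >>.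

Definition mutually_independent {I : choiceType}
    (F : I -> set_system Omega) : Prop :=
  forall (J : {fset I}) (E : I -> set Omega),
    (forall i, i \in J -> F i (E i)) ->
    P (\bigcap_(i in [set` J]) E i) = \prod_(i <- J) P (E i).

Definition independent (F G : set_system Omega) : Prop :=
  forall A B, F A -> G B -> P (A `&` B) = P A * P B.

(* The finite-dimensional laws of the simple random walk on Z^d started at x,
   in which every vertex has 2d neighbours: S_0 = x almost surely (s empty),
   and (S_1, ..., S_n) = s has probability (2d)^-n if (x, s) is a nearest
   neighbour path, and 0 otherwise. *)
Definition simple_random_walk {d : nat} (x : Zd d)
    (S : nat -> {RV P >-> Zd d}) : Prop :=
  forall s : seq (Zd d),
    P [set w | forall i, (i <= size s)%N -> S i w = nth x (x :: s) i] =
    (if path (@Zd_adj d) x s then ((2 * d)%:R ^- size s)%R else 0%R)%:E.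

End Independence.

(* A realization, on the probability space (Omega, P), of the frog model on Z^d
   whose lifetimes have the law of Xi; Xi may live on another space. *)
Record frog_model (R : realType) (d : nat)
    (disp0 : measure_display) (Omega0 : measurableType disp0)
    (P0 : probability Omega0 R) (Xi : {RV P0 >-> nat})
    (disp : measure_display) (Omega : measurableType disp)
    (P : probability Omega R) := FrogModel {
  lifetime : Zd d -> {RV P >-> nat};
  walk : Zd d -> nat -> {RV P >-> Zd d};
  lifetime_law : forall x (A : set nat),
    distribution P (lifetime x) A = distribution P0 Xi A;
  lifetime_indep : mutually_independent P
    (fun x => sigma_of (fun _ : unit => lifetime x : Omega -> nat));
  walk_law : forall x, simple_random_walk x (walk x);
  walk_indep : mutually_independent P
    (fun x => sigma_of (fun n => walk x n : Omega -> Zd d));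
  lifetime_walk_indep : independent P
    (sigma_of (fun x => lifetime x : Omega -> nat))
    (sigma_of (fun xn : Zd d * nat => walk xn.1 xn.2 : Omega -> Zd d)) }.

Section FrogModel.
Context {R : realType} {d : nat}.
Context {disp0 : measure_display} {Omega0 : measurableType disp0}.
Context {P0 : probability Omega0 R} {Xi : {RV P0 >-> nat}}.
Context {disp : measure_display} {Omega : measurableType disp}.
Context {P : probability Omega R}.
Variable F : frog_model d Xi P.
Local Open Scope ereal_scope.

(* t(x, y); the infimum of the empty set is +oo. *)
Definition hitting_time (w : Omega) (x y : Zd d) : \bar R :=
  ereal_inf [set n%:R%:E | n in
    [set n : nat | (n < lifetime F x w)%N /\ walk F x n w = y]].

(* t(x, x_1) + t(x_1, x_2) + ... + t(x_(m-1), x_m) for s = [x_1; ...; x_m] *)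
Fixpoint passage_time (w : Omega) (x : Zd d) (s : seq (Zd d)) : \bar R :=
  if s is y :: s' then hitting_time w x y + passage_time w y s' else 0.

(* T(x). As t(x, y) is only considered for x != y, consecutive terms of the
   sequences are distinct; the empty sequence gives T(0) = 0. *)
Definition activation_time (w : Omega) (x : Zd d) : \bar R :=
  ereal_inf [set passage_time w 0%R s | s in
    [set s : seq (Zd d) |
      path (fun y z => y != z) 0%R s /\ last 0%R s = x]].

Definition root_hit_at (w : Omega) (n : nat) : Prop :=
  exists (x : Zd d) (k j : nat),
    [/\ activation_time w x = k%:R%:E, (j < lifetime F x w)%N,
        walk F x j w = 0%R & n = (k + j)%N].

Definition root_hit_infinitely_often : set Omega :=
  [set w | infinite_set [set n : nat | root_hit_at w n]].

Definition recurrent : Prop := 0 < P root_hit_infinitely_often.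

End FrogModel.

(* Main.v *)
(** The argument is multiscale. In dimension d >= 2, suppose that all the frogs
  of the box B(k) = [-k, k]^d are activated. A given site y of B(k+1) is missed
  by all the frogs x <> 0 of B(k) with lifetime at least k^2 with probability at
  most exp(- q sum_x h(x, y)), where q = P(Xi >= k^2) and h(x, y) is the
  probability that a walk from x hits y before time k^2. By a last-exit
  decomposition, h is at least the expected number of visits times the
  probability v of not returning to y; by reversibility, summing over x gives
  the expected time spent in B(k) by a walk from y, which is at least c k^2.
  The escape probability v is bounded below by a constant if d >= 3, through the
  superharmonic function (a + |x|^2)^(-1/4), and by c / log k if d = 2, through
  the subharmonic function log (1 + |x|^2). Hence, if beta is large, y is missed
  with probability O(k^(-d-2)), and the union bound over y and k converges.
  In dimension 1 the same scheme is applied to the boxes B(2^k): it suffices to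
  visit the points 0 and +/- 2^(k+1), and a walk with lifetime of order 4^k does
  so with probability bounded below.
  The frog of the origin is not used in these events. With positive probability,
  and independently of them, it visits all the sites of the initial box. On this
  event 0 is visited by frogs of arbitrarily large lifetimes, hence coming from
  arbitrarily far, and such a frog is not activated before a time equal to its
  distance to 0. *)

Require Import Defs.
From HB Require Import structures.
From mathcomp Require Import all_boot all_order all_algebra finmap.
From mathcomp Require Import zify ring lra.
From mathcomp Require Import all_classical all_reals all_analysis.

Set Implicit Arguments.
Unset Strict Implicit.
Unset Printing Implicit Defensive.

Import Order.TTheory GRing.Theory Num.Theory.
Import numFieldNormedType.Exports.

Local Open Scope classical_set_scope.
Local Open Scope ring_scope.

(** * Averages over the steps of the simple random walk *)

Section Average.
Context {R : realType} {d : nat}.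
Implicit Types (h f g : Zd d -> R) (x y z : Zd d) (e : 'I_d * bool) (m N : nat).

Definition step e : Zd d :=
  if e.2 then delta_mx ord0 e.1 else - delta_mx ord0 e.1.

Definition avg h x : R := (2 * d)%:R^-1 * \sum_e h (x + step e).

Lemma avgE h x :
  avg h x = (2 * d)%:R^-1 *
    \sum_(i < d) (h (x + delta_mx ord0 i) + h (x - delta_mx ord0 i)).
Proof.
rewrite /avg -(pair_bigA _ (fun i b => h (x + step (i, b)))) /=.
by congr (_ * _); apply: eq_bigr => i _; rewrite big_bool.
Qed.

Lemma avg_le f g x :
  (forall e, f (x + step e) <= g (x + step e)) -> avg f x <= avg g x.
Proof.
by move=> le_fg; rewrite ler_wpM2l ?invr_ge0// ler_sum.
Qed.

Lemma iter_avg_le m f g x :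
  (forall z, f z <= g z) -> iter m avg f x <= iter m avg g x.
Proof. by move=> le_fg; elim: m x => //= m IHm x; apply: avg_le. Qed.

Lemma avgD f g x : avg (fun z => f z + g z) x = avg f x + avg g x.
Proof. by rewrite /avg big_split mulrDr. Qed.

Lemma avgZ c f x : avg (fun z => c * f z) x = c * avg f x.
Proof. by rewrite /avg -mulr_sumr mulrCA. Qed.

Lemma iter_avgD m f g :
  iter m avg (fun z => f z + g z) = fun x => iter m avg f x + iter m avg g x.
Proof.
by elim: m => //= m ->; apply/funext => x; rewrite avgD.
Qed.

Lemma iter_avgZ m c f : iter m avg (fun z => c * f z) = fun x => c * iter m avg
  f x.
Proof.
by elim: m => //= m ->; apply/funext => x; rewrite avgZ.
Qed.

Lemma iter_avg0 m : iter m avg (fun=> 0) = fun=> 0.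
Proof.
by elim: m => //= m ->; apply/funext => x; rewrite /avg big1 ?mulr0.
Qed.

Lemma iter_avg_sum m (I : Type) (s : seq I) (F : I -> Zd d -> R) :
  iter m avg (fun z => \sum_(i <- s) F i z) =
  fun x => \sum_(i <- s) iter m avg (F i) x.
Proof.
elim: s => [|i s IHs].
  by under eq_fun do rewrite big_nil; rewrite iter_avg0;
    under [RHS]eq_fun do rewrite big_nil.
under eq_fun do rewrite big_cons; rewrite iter_avgD IHs.
by under [RHS]eq_fun do rewrite big_cons.
Qed.

Lemma iter_avg_ge0 m f x : (forall z, 0 <= f z) -> 0 <= iter m avg f x.
Proof.
by move=> f0; have := iter_avg_le m x f0; rewrite iter_avg0.
Qed.

(** If [s] permutes the steps through [t], reindexing the sum over the steps shows that averaging
    commutes with [s]. This covers translations, negation and the coordinate reflections. *)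
Lemma iter_avg_symm m (s : Zd d -> Zd d) (t : 'I_d * bool -> 'I_d * bool) f :
  injective t -> (forall x e, s (x + step e) = s x + step (t e)) ->
  iter m avg (fun z => f (s z)) = fun x => iter m avg f (s x).
Proof.
move=> t_inj s_step; elim: m => //= m ->; apply/funext => x.
rewrite /avg [in RHS](reindex_inj t_inj).
by congr (_ * _); apply: eq_bigr => e _; rewrite s_step.
Qed.

Lemma avg_shift h y x : avg (fun z => h (z + y)) x = avg h (x + y).
Proof. by rewrite /avg; under eq_bigr do rewrite addrAC. Qed.

Lemma iter_avg_shift m f x : iter m avg f x = iter m avg (fun z => f (x + z)) 0.
Proof.
rewrite (iter_avg_symm m (s := +%R x) (t := id) f) ?addr0// => z e.
by rewrite addrA.
Qed.

Lemma stepN x e : - (x + step e) = - x + step (e.1, ~~ e.2).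
Proof. by rewrite /step opprD /=; case: e.2; rewrite //= opprK. Qed.

Lemma negstep_inj : injective (fun e => (e.1, ~~ e.2)).
Proof. by case=> i b [j c] [-> /negb_inj ->]. Qed.

Definition dirac_at y : Zd d -> R := fun x => (x == y)%:R.

(** Reversibility: both sides depend only on the displacement, and the walk from the origin is
    invariant under negation. *)
Lemma iter_avg_dirac_sym m x y :
  iter m avg (dirac_at y) x = iter m avg (dirac_at x) y.
Proof.
rewrite iter_avg_shift [RHS]iter_avg_shift.
have := congr1 (@^~ 0) (iter_avg_symm m
  (fun z => (y + z == x)%:R : R) negstep_inj stepN).
rewrite oppr0 => <-; congr (iter _ _ _ _).
apply/funext => z; rewrite /dirac_at.
by congr (nat_of_bool _)%:R; rewrite subr_eq eq_sym.
Qed.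

(* Time reversal: the number of walks from s expected at y at time m is the
   probability that a walk started at y is in s at time m. *)
Lemma sum_iter_avg_dirac m (s : seq (Zd d)) y : uniq s ->
  \sum_(x <- s) iter m avg (dirac_at y) x = iter m avg (fun z => (z \in s)%:R)
    y.
Proof.
move=> s_uniq.
under eq_bigr do rewrite iter_avg_dirac_sym.
rewrite -[LHS](congr1 (@^~ y) (iter_avg_sum m s dirac_at)).
congr (iter _ _ _ _); apply/funext => z.
rewrite /dirac_at -natr_sum -(count_uniq_mem z s_uniq) -sum1_count.
rewrite [in RHS]big_mkcond; congr (_%:R).
by apply: eq_bigr => x _; rewrite eq_sym /=; case: eqP.
Qed.

Hypothesis d_gt0 : (0 < d)%N.

Let dd_neq0 : (2 * d)%:R != 0 :> R.
Proof. by rewrite pnatr_eq0; lia. Qed.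

Lemma avg_cst c x : avg (fun=> c) x = c.
Proof.
rewrite /avg sumr_const card_prod card_ord card_bool -[c *+ _]mulr_natl.
by rewrite [in X in _ * X]mulnC mulKf.
Qed.

Lemma iter_avg_cst m c : iter m avg (fun=> c) = fun=> c.
Proof. by elim: m => //= m ->; apply/funext => x; rewrite avg_cst. Qed.

End Average.

(** * Hitting probabilities *)

Section Hitting.
Context {R : realType} {d : nat}.
Hypothesis d_gt0 : (0 < d)%N.
Implicit Types (h f g : Zd d -> R) (x y z : Zd d) (e : 'I_d * bool) (m N : nat).

(* The probability that a walk started at x visits y before time N. *)
Fixpoint hit_prob N y x : R :=
  if N is N'.+1 then if x == y then 1 else avg (hit_prob N' y) x else 0.

Lemma hit_prob_ge0 N y x : 0 <= hit_prob N y x.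
Proof.
elim: N x => //= N IHN x; case: ifP => // _.
by have := @avg_le R d (fun=> 0) _ x (fun e => IHN (x + step e));
  rewrite avg_cst.
Qed.

Lemma hit_prob_le1 N y x : hit_prob N y x <= 1.
Proof.
elim: N x => //= N IHN x; case: ifP => // _.
by have := @avg_le R d _ (fun=> 1) x (fun e => IHN (x + step e));
  rewrite avg_cst.
Qed.

(** Maximum principle, by induction on the horizon: away from [y] both functions are compared
    through their averages, and at [y] the bound [1 <= f y] suffices. *)
Lemma hit_prob_le_superharmonic f y : (forall x, 0 <= f x) -> 1 <= f y ->
  (forall x, x != y -> avg f x <= f x) -> forall N x, hit_prob N y x <= f x.
Proof.
move=> f_ge0 fy f_super; elim=> //= N IHN x.
have [->//|xy] := eqVneq x y.
by apply: le_trans (f_super x xy); apply: avg_le.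
Qed.

(* Last-exit decomposition: v bounds from below the probability that a walk
   started at y does not return to y by time M. *)
Lemma hit_prob_ge_green v M y : 0 <= v -> v <= 1 - avg (hit_prob M y) y ->
  forall N x, (N <= M.+1)%N ->
  v * \sum_(m < N) iter m avg (dirac_at y) x <= hit_prob N y x.
Proof.
move=> v_ge0 v_le; elim=> [x _|N IHN x NM]; first by rewrite big_ord0 mulr0.
have NM' : (N <= M.+1)%N by lia.
have le_avg : v * \sum_(m < N) iter m.+1 avg (dirac_at y) x <=
    avg (hit_prob N y) x.
  rewrite mulr_sumr /=; under eq_bigr do rewrite -avgZ.
  have -> : \sum_(m < N) avg (fun z => v * iter m avg (dirac_at y) z) x =
      avg (fun z => \sum_(m < N) v * iter m avg (dirac_at y) z) x.
    exact/esym/(congr1 (@^~ x) (iter_avg_sum 1 (index_enum _)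
      (fun (m : 'I_N) z => v * iter m avg (dirac_at y) z))).
  by apply: avg_le => e; rewrite -mulr_sumr IHN.
rewrite big_ord_recl /= mulrDr /dirac_at.
(* Away from [y], time 0 contributes no visit. At [y] the hitting probability is 1, and the later
   visits must fit into [1 - v]: this is the escape bound. *)
have [xy|xy] := eqVneq x y; last by rewrite mulr0 add0r.
subst x; rewrite mulr1 -lerBrDl.
apply: le_trans le_avg _.
(* Hitting probabilities increase with the horizon, and [N <= M] here. *)
have : avg (hit_prob N y) y <= avg (hit_prob M y) y.
  apply: avg_le => e.
  move: NM; rewrite ltnS => /subnKC <-; move: (M - N)%N => k.
  elim: k {v_le IHN NM'} (y + step e) => [|k IHk] z; first by rewrite addn0.
  apply: le_trans (IHk z) _; rewrite addnS.
  elim: {IHk} (N + k)%N z => [|l IHl] z; first exact: hit_prob_ge0.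
  by rewrite /=; case: ifP => // _; apply: avg_le.
by move: v_le; lra.
Qed.

Definition sqnorm x : R := \sum_(i < d) (x ord0 i)%:~R ^+ 2.

Lemma sqnorm_ge0 x : 0 <= sqnorm x.
Proof. by apply: sumr_ge0 => i _; rewrite sqr_ge0. Qed.

Lemma sqnorm0 : sqnorm 0 = 0.
Proof. by rewrite /sqnorm big1// => i _; rewrite mxE expr0n. Qed.

Lemma sqnorm_step x e : sqnorm (x + step e) =
  sqnorm x + 1 + (-1) ^+ (~~ e.2) * 2 * (x ord0 e.1)%:~R.
Proof.
case: e => i b /=.
rewrite /sqnorm (bigD1 i)//= [in RHS](bigD1 i)//=.
under eq_bigr => j ji.
  have -> : (x + step (i, b)) ord0 j = x ord0 j.
    by rewrite /step; case: b; rewrite !mxE /= (negPf ji) ?oppr0 addr0.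
  over.
rewrite /step; case: b; rewrite !mxE /= eqxx intrD ?rmorphN /= ?rmorph1; ring.
Qed.

Lemma coord_step_sqr x e : (x ord0 e.1)%:~R ^+ 2 <= sqnorm x :> R.
Proof.
rewrite /sqnorm (bigD1 e.1)//= lerDl; apply: sumr_ge0 => j _.
by rewrite sqr_ge0.
Qed.

(** The terms linear in the coordinates cancel between opposite steps, so each step adds exactly 1
    on average. *)
Lemma iter_avg_sqnorm m x : iter m avg sqnorm x = sqnorm x + m%:R.
Proof.
elim: m x => [x|m IHm x] /=; first by rewrite addr0.
rewrite (_ : iter m avg sqnorm = fun z => sqnorm z + m%:R); last exact/funext.
rewrite avgD avg_cst// avgE.
under eq_bigr => i _.
  rewrite (sqnorm_step x (i, true)) (sqnorm_step x (i, false)) /=.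
  have -> : sqnorm x + 1 + (-1) ^+ 0 * 2 * (x ord0 i)%:~R +
     (sqnorm x + 1 + (-1) ^+ 1 * 2 * (x ord0 i)%:~R) =
     (2 * (sqnorm x + 1)) :> R by ring.
  over.
rewrite sumr_const card_ord -[_ *+ d]mulr_natl mulrA natrM.
have : d%:R != 0 :> R by rewrite pnatr_eq0; lia.
by rewrite -natr1 => ?; field.
Qed.

End Hitting.

(** * Escape probabilities *)

Section Escape.
Context {R : realType}.

(* In terms of s = (1 + t) ^ (1/4), this is
   (1 + t) ^ (-1/4) <= 1 - t/4 + t^2/6 for t close to 0 (or larger); the
   second-order Taylor coefficient is 5/32 < 1/6. *)
Lemma fourth_root_inv_le (s : R) : 49/50 <= s ->
  s^-1 <= 1 - (s ^+ 4 - 1) / 4 + (s ^+ 4 - 1) ^+ 2 / 6.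
Proof.
move=> s_ge; have s_gt0 : 0 < s by lra.
rewrite -div1r ler_pdivrMr//.
pose r := s - 49/50; have r_ge0 : 0 <= r by rewrite /r; lra.
rewrite (_ : s = r + 49/50); last by rewrite /r; ring.
rewrite -subr_ge0.
(* The difference has a double zero at [s = 1], with cofactor [q]. In powers of [r], all
   coefficients of [q] are positive; the constant one is only about 0.01. *)
set q := (r + 49/50) ^+ 7 / 6 + (r + 49/50) ^+ 6 / 3 +
  (r + 49/50) ^+ 5 / 2 + (r + 49/50) ^+ 4 * 2 / 3 +
  (r + 49/50) ^+ 3 / 4 - (r + 49/50) ^+ 2 / 6 - (r + 49/50) * 7 / 12 - 1.
have -> : (1 - ((r + 49/50) ^+ 4 - 1) / 4 +
    ((r + 49/50) ^+ 4 - 1) ^+ 2 / 6) * (r + 49/50) - 1 =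
  (r + 49/50 - 1) ^+ 2 * q by rewrite /q; field.
apply: mulr_ge0; first exact: sqr_ge0.
have rX n : 0 <= r ^+ n by exact: exprn_ge0.
move: (rX 2%N) (rX 3%N) (rX 4%N) (rX 5%N) (rX 6%N) (rX 7%N).
rewrite /q; lra.
Qed.

(* green_weight (a + |x|^2) decays like |x|^(-1/2); it is superharmonic on Z^d
   for d >= 3 once a is large enough. *)
Definition green_weight (u : R) : R := (Num.sqrt (Num.sqrt u))^-1.

Lemma green_weight_gt0 u : 0 < u -> 0 < green_weight u.
Proof. by move=> u0; rewrite invr_gt0 !sqrtr_gt0. Qed.

(** Scaling by [u] reduces the claim to [fourth_root_inv_le] with [s^4 = 1 + v / u]; the threshold
    12/13 fits since [(49/50)^4 <= 12/13]. *)
Lemma green_weight_le u v : 0 < u -> 12/13 * u <= u + v ->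
  green_weight (u + v) <=
  green_weight u * (1 - v / u / 4 + (v / u) ^+ 2 / 6).
Proof.
move=> u_gt0 uv.
have u_neq0 : u != 0 by lra.
have -> : u + v = u * (1 + v / u) by field.
set t := v / u; have t_ge : 12/13 <= 1 + t.
  have -> : 1 + t = (u + v) / u by rewrite /t; field.
  by rewrite ler_pdivlMr.
have t_ge0 : 0 <= 1 + t by clear -t_ge; lra.
rewrite /green_weight sqrtrM; last exact: ltW.
rewrite sqrtrM ?sqrtr_ge0// invfM ler_wpM2l ?invr_ge0 ?sqrtr_ge0//.
set s := Num.sqrt (Num.sqrt (1 + t)).
have s4 : s ^+ 4 = 1 + t.
  by rewrite (exprM _ 2 2) sqr_sqrtr ?sqrtr_ge0// sqr_sqrtr.
have s_ge : 49/50 <= s.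
  by rewrite -(@ler_pXn2r _ 4) ?nnegrE ?sqrtr_ge0// s4; apply: le_trans t_ge;
    clear; lra.
have := fourth_root_inv_le s_ge; rewrite s4.
by rewrite (_ : 1 + t - 1 = t)//; ring.
Qed.

(** Opposite steps cancel the terms linear in [x]. Up to the factor [green_weight u], the
    first-order terms then lose [d / (2 u)] in total and the second-order terms gain
    [(d + 4 S) / (3 u^2)]; the loss wins when [d >= 3] because [S < u]. *)
Lemma green_weight_superharmonic (d : nat) (a : R) (x : Zd d) :
  (3 <= d)%N -> 200 <= a ->
  avg (fun z => green_weight (a + sqnorm z)) x <= green_weight (a + sqnorm x).
Proof.
move=> d_ge3 a_ge; rewrite avgE.
have := @sqnorm_ge0 R d x; set S := sqnorm x => S_ge0.
set u := a + S; have u_ge : 200 + S <= u by rewrite lerD2r.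
have u_gt0 : 0 < u by lra.
have u_neq0 : u != 0 by rewrite gt_eqF.
have d3 : 3 <= d%:R :> R by rewrite (ler_nat R 3).
rewrite natrM mulrC ler_pdivrMr; last by clear -d3; lra.
have pair (i : 'I_d) :
    green_weight (a + sqnorm (x + delta_mx ord0 i)) +
    green_weight (a + sqnorm (x - delta_mx ord0 i)) <=
    green_weight u * (2 - u^-1 / 2 +
      (1 + 4 * (x ord0 i)%:~R ^+ 2) / u ^+ 2 / 3).
  have := @coord_step_sqr R d x (i, true).
  rewrite (sqnorm_step x (i, true)) (sqnorm_step x (i, false)) -/S /=.
  set c := (x ord0 i)%:~R => c_le.
  have -> : a + (S + 1 + (-1) ^+ 0 * 2 * c) = u + (1 + 2 * c).
    by rewrite /u; ring.
  have -> : a + (S + 1 + (-1) ^+ 1 * 2 * c) = u + (1 - 2 * c).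
    by rewrite /u; ring.
  (* This yields [2 |c| <= u / 13], as the threshold 12/13 requires. It follows from
     [c^2 <= u - 200] and [676 (u - 200) <= u^2], by completing the square at 338 = 676/2. *)
  have c_sqr : (26 * c) ^+ 2 <= u ^+ 2.
    have := sqr_ge0 (u - 338); clear -c_le u_ge; lra.
  have : `|26 * c| <= u.
    by rewrite -(ger0_norm (ltW u_gt0)) -ler_sqr ?nnegrE// !real_normK//
      num_real.
  rewrite ler_norml => /andP[c_ge c_ge'].
  have H1 : 12/13 * u <= u + (1 + 2 * c) by clear -c_ge; lra.
  have H2 : 12/13 * u <= u + (1 - 2 * c) by clear -c_ge'; lra.
  have := lerD (green_weight_le u_gt0 H1) (green_weight_le u_gt0 H2).
  move/le_trans; apply; rewrite -mulrDr ler_wpM2l//.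
    exact/ltW/green_weight_gt0.
  by rewrite le_eqVlt; apply/orP; left; apply/eqP; field.
apply: (le_trans (ler_sum _ (fun i _ => pair i))).
rewrite -mulr_sumr ler_wpM2l//; first exact/ltW/green_weight_gt0.
rewrite big_split/= sumr_const card_ord -mulr_suml -mulr_suml big_split/=.
rewrite sumr_const card_ord -mulr_sumr -/(sqnorm x) -/S.
rewrite -[(_ - _) *+ d]mulr_natl.
rewrite -subr_ge0.
have -> : 2 * d%:R - (d%:R * (2 - u^-1 / 2) +
    (d%:R + 4 * S) / u ^+ 2 / 3) =
    (d%:R * u / 2 - (d%:R + 4 * S) / 3) / u ^+ 2 by field.
rewrite divr_ge0 ?sqr_ge0//.
have : 3 * (u / 2 - 1/3) <= d%:R * (u / 2 - 1/3).
  by apply: ler_wpM2r => //; clear -u_ge S_ge0; lra.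
clear -u_ge S_ge0; lra.
Qed.

(** The superharmonic function centred at [y] and normalised to 1 at [y] dominates the hitting
    probability of [y]. At the neighbours of [y] it takes one value below 1, whatever [N] and
    [y]. *)
Lemma escape_prob_ge3 (d : nat) : (3 <= d)%N ->
  exists2 v : R, 0 < v <= 1 &
  forall N (y : Zd d), v <= 1 - avg (hit_prob N y) y.
Proof.
move=> d_ge3; have d_gt0 : (0 < d)%N by lia.
have [a a_ge] : exists a : R, 200 <= a by exists 200.
have a_gt0 : 0 < a by lra.
have a1_gt0 : 0 < a + 1 by lra.
have g0 : 0 < green_weight a by exact: green_weight_gt0.
have gV : 0 <= (green_weight a)^-1 by rewrite invr_ge0 ltW.
have g1 : 0 < green_weight (a + 1) by exact: green_weight_gt0.
have g_lt : green_weight (a + 1) < green_weight a.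
  by rewrite ltf_pV2 ?posrE ?sqrtr_gt0// !ltr_sqrt ?sqrtr_gt0// ltrDl.
exists (1 - green_weight (a + 1) / green_weight a).
  apply/andP; split; first by rewrite subr_gt0 ltr_pdivrMr ?mul1r.
  by rewrite gerBl divr_ge0 ?ltW.
move=> N y; rewrite lerD2l lerN2.
pose f (x : Zd d) := (green_weight a)^-1 * green_weight (a + sqnorm (x - y)).
have hit_le x : hit_prob N y x <= f x.
  apply: hit_prob_le_superharmonic => //.
  - move=> z; apply: mulr_ge0; first by [].
    by apply/ltW/green_weight_gt0; rewrite ltr_wpDr ?sqnorm_ge0.
  - by rewrite /f subrr sqnorm0 addr0 mulVf// gt_eqF.
  - move=> z _; rewrite avgZ; apply: ler_wpM2l => //.
    have /= -> := avg_shift (fun w => green_weight (a + sqnorm w)) (- y) z.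
    exact: green_weight_superharmonic.
apply: (@le_trans _ _ (avg f y)); first by apply: avg_le => e.
apply: (@le_trans _ _ (avg (fun=> green_weight (a + 1) / green_weight a) y)).
  apply: avg_le => e; rewrite /f mulrC addrAC subrr add0r.
  rewrite ler_wpM2r// -[step e]add0r sqnorm_step sqnorm0.
  by rewrite mxE mulr0 addr0 add0r.
by rewrite avg_cst.
Qed.

(* With u = 1 + |x|^2, the claim is that the product of the four neighbouring
   values u + 1 +/- 2 x_i is at least u^4. *)
Lemma ln_sqnorm_subharmonic (x : Zd 2) :
  ln (1 + sqnorm x) <= avg (fun z => ln (1 + sqnorm z)) x :> R.
Proof.
rewrite avgE !big_ord_recl big_ord0 addr0.
pose a : R := (x ord0 ord0)%:~R; pose b : R := (x ord0 (lift ord0 ord0))%:~R.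
rewrite (sqnorm_step x (ord0, true)) (sqnorm_step x (ord0, false)).
rewrite (sqnorm_step x (lift ord0 ord0, true)).
rewrite (sqnorm_step x (lift ord0 ord0, false)) /= -/a -/b.
have -> : sqnorm x = a ^+ 2 + b ^+ 2.
  by rewrite /sqnorm !big_ord_recl big_ord0 addr0.
set u := 1 + _; rewrite ler_pdivlMl//.
have a2 := sqr_ge0 a; have b2 := sqr_ge0 b.
have u_gt0 : 0 < u by rewrite /u; lra.
have p1 : 0 < 1 + (a ^+ 2 + b ^+ 2 + 1 + (-1) ^+ 0 * 2 * a).
  by have := sqr_ge0 (a + 1); lra.
have p2 : 0 < 1 + (a ^+ 2 + b ^+ 2 + 1 + (-1) ^+ 1 * 2 * a).
  by have := sqr_ge0 (a - 1); lra.
have p3 : 0 < 1 + (a ^+ 2 + b ^+ 2 + 1 + (-1) ^+ 0 * 2 * b).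
  by have := sqr_ge0 (b + 1); lra.
have p4 : 0 < 1 + (a ^+ 2 + b ^+ 2 + 1 + (-1) ^+ 1 * 2 * b).
  by have := sqr_ge0 (b - 1); lra.
rewrite -!lnM ?posrE ?mulr_gt0//.
rewrite mulr_natl -lnXn//.
rewrite ler_ln ?posrE ?mulr_gt0 ?exprn_gt0// -subr_ge0.
rewrite (_ : _ - _ = 2 * (a ^+ 2 + b ^+ 2 + 1) ^+ 2 + 8 * (a ^+ 2 + b ^+ 2 + 1)
  + 5 + 16 * (a ^+ 2 * b ^+ 2)).
  have := mulr_ge0 a2 b2; have := sqr_ge0 (a ^+ 2 + b ^+ 2 + 1); lra.
rewrite /u -[(2 * 2)%N]/4%N. ring.
Qed.

(** The right-hand side is superharmonic and equals 1 at [y], but is negative far away. The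
    hypothesis keeps every coordinate within [M.+1] of [y] during the remaining [N] steps, so that
    the squared distance is at most [2 (M + 1)^2] and the bound stays nonnegative. *)
Lemma hit_prob_le_ln (M N : nat) (x y : Zd 2) :
  (forall i, `|x ord0 i - y ord0 i|%N + N <= M.+1)%N ->
  hit_prob N y x <= 1 - ln (1 + sqnorm (x - y)) / ln (1 + 2 * (M.+1%:R ^+ 2))
    :> R.
Proof.
set L := ln (1 + 2 * _).
have L_gt0 : 0 < L by apply: ln_gt0; rewrite ltrDl mulr_gt0// exprn_gt0.
elim: N x => [|N IHN] x xM /=.
  rewrite subr_ge0 ler_pdivrMr// mul1r.
  have p1 : 0 < 1 + sqnorm (x - y) :> R by rewrite ltr_pwDl ?sqnorm_ge0.
  have p2 : 0 < 1 + 2 * M.+1%:R ^+ 2 :> R.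
    by rewrite ltr_pwDl// mulr_ge0// exprn_ge0.
  rewrite /L ler_ln ?posrE//.
  rewrite lerD2l /sqnorm -[2%:R](_ : \sum_(i < 2) 1 = _); last first.
    by rewrite sumr_const card_ord.
  rewrite mulr_suml; apply: ler_sum => i _.
  rewrite mul1r.
  have : (x - y) ord0 i ^+ 2 <= (M.+1)%:Z ^+ 2.
    rewrite !mxE; have := xM i; rewrite addn0.
    by rewrite -[X in X <= _]real_normK ?num_real// -abszE ler_sqr ?nnegrE.
  by rewrite -(ler_int R) !rmorphXn.
have [->|xy] := eqVneq x y.
  by rewrite subrr sqnorm0 addr0 ln1 mul0r subr0.
apply: (@le_trans _ _ (avg (fun z => 1 + - (L^-1) * ln (1 + sqnorm (z - y)))
  x)).
  apply: avg_le => e; rewrite mulNr mulrC; apply: IHN => i.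
  have := xM i; rewrite /step; case: e => j [] /=; rewrite !mxE;
    case: (_ && _) => /=; lia.
rewrite (avgD (fun=> 1) (fun z => - L^-1 * ln (1 + sqnorm (z - y)))) avgZ
  avg_cst// lerD2l mulNr lerN2 mulrC.
apply: ler_wpM2l; first by rewrite invr_ge0 ltW.
have /= -> := avg_shift (fun w => ln (1 + sqnorm w) : R) (- y) x.
exact: ln_sqnorm_subharmonic.
Qed.

(** The neighbours of [y] are at squared distance 1, hence [ln 2]; one step followed by [N] others
    stays within distance [N.+1], so [M = N] is allowed. *)
Lemma escape_prob_ge2 (N : nat) (y : Zd 2) :
  ln 2 / ln (1 + 2 * (N.+1%:R ^+ 2)) <= 1 - avg (hit_prob N y) y :> R.
Proof.
set L := ln (1 + 2 * _).
rewrite lerBrDl -lerBrDr.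
apply: (@le_trans _ _ (avg (fun=> 1 - ln 2 / L) y)); last by rewrite avg_cst.
apply: avg_le => e.
apply: le_trans (hit_prob_le_ln (M := N) _) _ => [i|].
  rewrite /step; case: e => j [] /=; rewrite !mxE; case: (_ && _) => /=; lia.
rewrite addrAC subrr add0r -[step e]add0r sqnorm_step sqnorm0 mxE mulr0 addr0.
by rewrite add0r.
Qed.

End Escape.

(** * Boxes and paths *)

Section Lattice.
Context {d : nat}.
Implicit Types (x y z : Zd d) (e : 'I_d * bool).

Definition box n : seq (Zd d) :=
  [seq (\row_i ((f i)%:Z - n%:Z) : Zd d) | f : {ffun 'I_d -> 'I_(2 * n).+1}].

Lemma Zd_ext x y : (forall i, x ord0 i = y ord0 i) -> x = y.
Proof. by move=> xy; apply/matrixP => i j; rewrite (ord1 i) [LHS]xy. Qed.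

Lemma mem_box n x : (x \in box n) = [forall i, `|x ord0 i| <= n]%N.
Proof.
apply/fintype.imageP/forallP => [[f _ ->] i|xn].
  by rewrite mxE; have := ltn_ord (f i); move: (nat_of_ord _) => a; lia.
have lt_f (i : 'I_d) : (`|(x ord0 i + n%:Z)%R| < (2 * n).+1)%N.
  by have := xn i; lia.
exists [ffun i => Ordinal (lt_f i)] => //.
apply: Zd_ext => j; rewrite mxE ffunE /=.
by move: (xn j); move: (x ord0 j) => a; lia.
Qed.

Lemma box_uniq n : uniq (box n).
Proof.
rewrite map_inj_uniq ?enum_uniq// => f g fg; apply/ffunP => i; apply: val_inj.
have := congr1 (fun A : 'rV_d => A ord0 i) fg; rewrite !mxE /=;
  move: (nat_of_ord _) => a; move: (nat_of_ord _) => b; lia.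
Qed.

Lemma size_box n : size (box n) = ((2 * n).+1 ^ d)%N.
Proof. by rewrite size_map -cardE card_ffun !card_ord. Qed.

Lemma box0 n : 0 \in box n.
Proof. by rewrite mem_box; apply/forallP => i; rewrite mxE. Qed.

Definition dist1 x y : nat := (\sum_(i < d) `|x ord0 i - y ord0 i|)%N.

Lemma dist1_eq0 x y : (dist1 x y == 0)%N = (x == y).
Proof.
rewrite /dist1 sum_nat_eq0; apply/forallP/eqP => [xy|-> i].
  apply: Zd_ext => i; have := xy i; rewrite /=; lia.
by rewrite subrr.
Qed.

Lemma step_coord x e j : (x + step e) ord0 j =
  x ord0 j + (if j == e.1 then if e.2 then 1 else -1 else 0).
Proof.
by rewrite /step; case: e => i [] /=; rewrite !mxE /=; case: (j == i).
Qed.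

Lemma step_inj : injective (@step d).
Proof.
case=> i b [i' b'] ee'; have := congr1 (fun z : Zd d => (0 + z) ord0 i) ee'.
rewrite !step_coord mxE !add0r /= eqxx; case: eqVneq => [<-|_];
  last by case: b {ee'}.
by case: b {ee'}; case: b'.
Qed.

Lemma Zd_adj_step x e : Zd_adj x (x + step e).
Proof.
rewrite /Zd_adj (bigD1 e.1)//= big1 => [|j je].
  by rewrite step_coord eqxx addn0 opprD addrA subrr sub0r; case: e.2.
by rewrite step_coord (negPf je) addr0 subrr.
Qed.

Lemma Zd_adjP x y : reflect (exists e, y = x + step e) (Zd_adj x y).
Proof.
apply: (iffP idP) => [|[e ->]]; last exact: Zd_adj_step.
move=> /eqP xy.
have [i xyi] : exists i, x ord0 i != y ord0 i.
  apply/existsP; rewrite -negb_forall; apply/negP => /forallP xy'.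
  by move: xy; rewrite big1// => i _; rewrite (eqP (xy' i)) subrr.
move: xy; rewrite (bigD1 i)//=; set S := (\sum_(_ < _ | _) _)%N => xy.
have /eqP : (S = 0)%N by move: xyi xy; lia.
rewrite sum_nat_eq0 => /forallP xyj.
exists (i, x ord0 i < y ord0 i); apply: Zd_ext => j.
rewrite step_coord /=.
have [->|ji] := eqVneq j i.
  by have [|] := boolP (_ < _); move: xyi xy; lia.
by have := xyj j; rewrite ji /=; lia.
Qed.

Lemma Zd_path_ex x y : exists2 s : seq (Zd d), path (@Zd_adj d) x s &
  last x s = y /\ size s = dist1 x y.
Proof.
move Ek: (dist1 x y) => k; elim: k x Ek => [|k IHk] x xy.
  by exists [::] => //; split=> //; apply/eqP; rewrite -dist1_eq0 xy.
have [i xyi] : exists i, x ord0 i != y ord0 i.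
  apply/existsP; rewrite -negb_forall; apply/negP => /forallP xy'.
  by move: xy; rewrite /dist1 big1// => i _; rewrite (eqP (xy' i)) subrr.
pose e := (i, x ord0 i < y ord0 i).
have [|s xs [ys ss]] := IHk (x + step e).
  move: xy; rewrite /dist1 (bigD1 i)//= [in X in _ -> X](bigD1 i)//=.
  under [in X in _ -> X]eq_bigr => j ji.
    by rewrite step_coord /= (negPf ji) addr0; over.
  rewrite step_coord eqxx /=.
  by have [|] := boolP (_ < _); move: xyi; lia.
by exists (x + step e :: s) => /=; rewrite ?Zd_adj_step// ss.
Qed.

(** Clamping each coordinate to [[-n, n]] moves it by at most 1, so the clamped point is at distance
    at most [d]. *)
Lemma box_succ_path n y : y \in box n.+1 ->
  exists2 s : seq (Zd d), path (@Zd_adj d) y s &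
  last y s \in box n /\ (size s <= d)%N.
Proof.
rewrite mem_box => /forallP yn.
pose c i : int := if n%:Z < y ord0 i then n%:Z
  else if y ord0 i < - n%:Z then - n%:Z else y ord0 i.
have [s ys [sl ss]] := Zd_path_ex y (\row_i c i : Zd d).
exists s => //; rewrite sl ss; split.
  rewrite mem_box; apply/forallP => i; rewrite mxE /c.
  by have := yn i; do 2?case: ifP; lia.
rewrite -[leqRHS](_ : \sum_(i < d) 1 = d)%N; last by rewrite sum1_card card_ord.
apply: leq_sum => i _; rewrite mxE /c.
by have := yn i; do 2?case: ifP; lia.
Qed.

Definition flip_signs (b : {ffun 'I_d -> bool}) x : Zd d :=
  \row_i (if b i then - x ord0 i else x ord0 i).

Definition flip_step (b : {ffun 'I_d -> bool}) e := (e.1, e.2 (+) b e.1).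

Lemma flip_step_inj b : injective (flip_step b).
Proof.
by case=> i [] [j []] [<-]; rewrite /=; case: (b i).
Qed.

Lemma flip_signsD b x e :
  flip_signs b (x + step e) = flip_signs b x + step (flip_step b e).
Proof.
apply: Zd_ext => j; rewrite step_coord [LHS]mxE step_coord mxE /=.
by have [->|_] := eqVneq j e.1; case: (b _); case: e.2; rewrite /=; lia.
Qed.

End Lattice.

(** * Expected time spent in a box *)

Section Occupation.
Context {R : realType} {d : nat}.
Hypothesis d_gt0 : (0 < d)%N.
Implicit Types (x y z : Zd d) (e : 'I_d * bool).

Definition in_box n : Zd d -> R := fun z => (z \in box n)%:R.

(* By Chebyshev, all coordinates of the displacement are at most n in absolute
   value with the probability on the left; one of the 2^d reflections of the
   coordinates then moves y towards the centre of the box. *)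
Lemma iter_avg_in_box_ge n m y : (0 < n)%N -> y \in box n ->
  1 - m%:R / n%:R ^+ 2 <= 2 ^+ d * iter m avg (in_box n) y.
Proof.
move=> n_gt0; rewrite mem_box => /forallP yn.
have n2_gt0 : 0 < n%:R ^+ 2 :> R by rewrite exprn_gt0 ?ltr0n.
(* The walk is invariant under the [2^d] coordinate reflections, so the factor [2^d] becomes a sum
   over the reflected displacements. *)
have -> : 2 ^+ d * iter m avg (in_box n) y =
  iter m avg (fun z => \sum_(b : {ffun 'I_d -> bool})
    in_box n (y + flip_signs b z)) 0.
  have /(congr1 (@^~ 0)) -> := iter_avg_sum m (index_enum _)
    (fun (b : {ffun 'I_d -> bool}) z => in_box n (y + flip_signs b z)).
  rewrite iter_avg_shift.
  under eq_bigr => b _.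
    have /(congr1 (@^~ 0)) /= -> := iter_avg_symm m (fun z => in_box n (y + z))
      (@flip_step_inj d b) (flip_signsD b).
    have -> : flip_signs b 0 = 0.
      by apply: Zd_ext => j; rewrite !mxE; case: (b j); rewrite ?oppr0.
    over.
  by rewrite sumr_const card_ffun card_bool card_ord -[RHS]mulr_natl natrX.
(* This is the mean of [1 - |z|^2 / n^2], now to be compared pointwise with the number of
   reflections of [z] that keep the endpoint in the box. *)
have -> : 1 - m%:R / n%:R ^+ 2 =
    iter m avg (fun z => 1 + (- (n%:R ^- 2)) * sqnorm z) 0 :> R.
  rewrite (iter_avgD m (fun=> 1)) iter_avgZ iter_avg_cst// iter_avg_sqnorm//.
  by rewrite sqnorm0 add0r mulNr mulrC.
apply: iter_avg_le => z.
have [zn|] := boolP [forall i, `|z ord0 i| <= n]%N; last first.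
  rewrite negb_forall => /existsP[i]; rewrite -ltnNge => zi.
  apply: (@le_trans _ _ 0); last by apply: sumr_ge0.
  rewrite mulNr subr_le0 mulrC ler_pdivlMr// mul1r.
  apply: le_trans (@coord_step_sqr R d z (i, true)) => /=.
  have : n%:Z ^+ 2 <= z ord0 i ^+ 2.
    by rewrite -[X in _ <= X]real_normK ?num_real// -abszE ler_sqr ?nnegrE//
      lez_nat ltnW.
  by rewrite -(ler_int R) !rmorphXn.
apply: (@le_trans _ _ 1).
  by rewrite gerDl mulNr oppr_le0 mulr_ge0 ?sqnorm_ge0// invr_ge0 ltW.
(* A coordinate of [z] is flipped when its sign agrees with that of [y], so that the sum of the two
   stays in [[-n, n]]. *)
pose b := [ffun i => (0 <= y ord0 i) == (0 <= z ord0 i)].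
rewrite (bigD1 b)//= -[leLHS]addr0 lerD ?sumr_ge0//.
rewrite /in_box mem_box (_ : [forall _, _])//; apply/forallP => i.
rewrite !mxE ffunE; have := forallP zn i; have := yn i.
move: (y ord0 i) (z ord0 i) => a c.
by case: eqP; case: (boolP (0 <= a)); case: (boolP (0 <= c)); lia.
Qed.

(** Forcing the first steps along [s] costs a factor [2 d] per step: a single term of each average
    is kept. *)
Lemma iter_avg_path (f : Zd d -> R) m x s : (forall z, 0 <= f z) ->
  path (@Zd_adj d) x s ->
  (2 * d)%:R ^- size s * iter m avg f (last x s) <=
  iter (size s + m) avg f x.
Proof.
move=> f_ge0; elim: s x => [|y s IHs] x /=; first by rewrite invr1 mul1r.
move=> /andP[/Zd_adjP[e ->]] /IHs IH.
rewrite exprS invfM -mulrA /avg ler_wpM2l ?invr_ge0//.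
rewrite (bigD1 e)//= -[leLHS]addr0 lerD//.
by apply: sumr_ge0 => e' _; apply: iter_avg_ge0.
Qed.

(** The factors come from a path of at most [d] steps into the box, from the [2^d] reflections, and
    from 1/8 = 1/2 (Chebyshev) times 1/4 (at least [n^2 / 4] times are counted). *)
Definition occupation_cst : R := (2 * d)%:R ^- d / 2 ^+ d / 8.

Lemma occupation_cst_gt0 : 0 < occupation_cst.
Proof. by rewrite !mulr_gt0 ?invr_gt0 ?exprn_gt0// ltr0n muln_gt0. Qed.

Lemma sum_iter_avg_in_box_ge n y : (d + 2 <= n)%N -> y \in box n.+1 ->
  occupation_cst * n%:R ^+ 2 <= \sum_(m < n ^ 2) iter m avg (in_box n) y.
Proof.
move=> dn /box_succ_path[s ys [sn sd]].
have in_box_ge0 z : 0 <= in_box n z by [].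
rewrite -(big_mkord xpredT (fun m => iter m avg (in_box n) y)).
(* The counted times start after the path [s] and end before [n^2], since [size s <= d <= n - 2]. *)
have n2 : (size s + n ^ 2 %/ 2 <= n ^ 2)%N by nia.
rewrite (big_cat_nat (leq0n (size s + n ^ 2 %/ 2)) n2) /=.
rewrite (big_cat_nat (leq0n (size s)) (leq_addr _ _)) /= -addrA.
rewrite -[leLHS]add0r lerD ?sumr_ge0// => [m _|]; first exact: iter_avg_ge0.
rewrite -[leLHS]addr0 lerD ?sumr_ge0// => [|m _]; last exact: iter_avg_ge0.
rewrite -{1}[size s]add0n big_addn addKn big_mkord.
apply: (@le_trans _ _ (\sum_(m < n ^ 2 %/ 2) 4 * occupation_cst)).
  rewrite sumr_const card_ord -[_ *+ (_ %/ _)]mulr_natl mulrA mulrC.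
  rewrite ler_wpM2r ?(ltW occupation_cst_gt0)// -natrX -natrM ler_nat.
  nia.
apply: ler_sum => m _; rewrite addnC.
apply: le_trans (iter_avg_path m in_box_ge0 ys).
have n_gt0 : (0 < n)%N by lia.
have := iter_avg_in_box_ge m n_gt0 sn.
set a := iter _ _ _ _ => Ha.
have a_ge : 2^-1 <= 2 ^+ d * a.
  apply: le_trans Ha.
  have : m%:R / n%:R ^+ 2 <= 2^-1 :> R.
    rewrite ler_pdivrMr ?exprn_gt0 ?ltr0n// ler_pdivlMl// -natrX -natrM ler_nat.
    by have := ltn_ord m; lia.
  lra.
have a_ge0 : 0 <= a by exact: iter_avg_ge0.
apply: (@le_trans _ _ ((2 * d)%:R ^- d * a)); last first.
  rewrite ler_wpM2r// lef_pV2 ?posrE ?exprn_gt0 ?ltr0n ?muln_gt0//.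
  by rewrite ler_weXn2l// ler1n muln_gt0.
rewrite /occupation_cst mulrC -!mulrA ler_wpM2l ?invr_ge0 ?exprn_ge0//.
rewrite ler_pdivrMl ?exprn_gt0//; apply: le_trans a_ge; lra.
Qed.

Lemma sum_hit_prob_ge (v : R) n y : (d + 2 <= n)%N -> y \in box n.+1 ->
  0 <= v -> v <= 1 - avg (hit_prob (n ^ 2) y) y ->
  v * occupation_cst * n%:R ^+ 2 <= \sum_(x <- box n) hit_prob (n ^ 2) y x.
Proof.
move=> dn yn v_ge0 v_le.
apply: (@le_trans _ _ (v * \sum_(m < n ^ 2) iter m avg (in_box n) y)).
  by rewrite -mulrA ler_wpM2l// sum_iter_avg_in_box_ge.
rewrite /in_box; under eq_bigr do rewrite -sum_iter_avg_dirac ?box_uniq//.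
rewrite exchange_big /= mulr_sumr; apply: ler_sum => x _.
by apply: (hit_prob_ge_green d_gt0 v_ge0 v_le); exact: leqnSn.
Qed.

End Occupation.

(** * The one-dimensional walk *)

Section OneDimension.
Context {R : realType}.
Implicit Types (x y z : Zd 1) (m N L : nat).

Definition coord1 x : R := (x ord0 ord0)%:~R.

Lemma coord1_step x e : coord1 (x + step e) = coord1 x + (-1) ^+ (~~ e.2).
Proof.
rewrite /coord1 step_coord (ord1 e.1) eqxx intrD.
by case: e.2; rewrite ?expr0 ?expr1// rmorphN.
Qed.

Lemma sqnorm1 x : sqnorm x = coord1 x ^+ 2.
Proof. by rewrite /sqnorm big_ord_recl big_ord0 addr0. Qed.

Lemma iter_avg_coord4 m x : iter m avg (fun z => coord1 z ^+ 4) x =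
  coord1 x ^+ 4 + 6 * m%:R * coord1 x ^+ 2 + (3 * m%:R ^+ 2 - 2 * m%:R).
Proof.
elim: m x => [|m IHm] x /=; first by ring.
rewrite (_ : iter m avg _ = fun z => coord1 z ^+ 4 +
  6 * m%:R * coord1 z ^+ 2 + (3 * m%:R ^+ 2 - 2 * m%:R)); last exact/funext.
rewrite avgE big_ord_recl big_ord0 addr0.
rewrite !(coord1_step x (ord0, true)) !(coord1_step x (ord0, false)) /=.
by rewrite -natr1 muln1; field.
Qed.

(* For s = z^2 / N, the function 16/169 (s - 1/2) (7 - s) is at most 1, and
   nonpositive if s <= 1/2; the moments of the walk give its average. *)
Lemma walk1_displacement L N : (0 < N)%N -> (2 * L ^ 2 <= N)%N ->
  8 / 169 <= iter N avg (fun z => (L%:Z <= z ord0 ord0)%R%:R : R) 0.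
Proof.
move=> N_gt0 LN.
set f := fun z : Zd 1 => (L%:Z <= z ord0 ord0)%R%:R : R.
(* By symmetry it is enough to bound the two-sided event, at the cost of a factor 2. *)
have fN : iter N avg (fun z => f (- z)) 0 = iter N avg f 0.
  by rewrite (iter_avg_symm N f negstep_inj stepN) oppr0.
suff : 16 / 169 <= iter N avg (fun z => f z + f (- z)) 0.
  by rewrite iter_avgD fN; lra.
have NR_gt0 : 0 < N%:R :> R by rewrite ltr0n.
have NR_neq0 : N%:R != 0 :> R by rewrite gt_eqF.
pose p (z : Zd 1) : R := 16 / 169 * ((coord1 z ^+ 2 / N%:R - 2^-1) *
  (7 - coord1 z ^+ 2 / N%:R)).
have : iter N avg p 0 <= iter N avg (fun z => f z + f (- z)) 0.
  apply: iter_avg_le => z; rewrite /p; set s := _ / N%:R.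
  have s_ge0 : 0 <= s by rewrite divr_ge0 ?sqr_ge0// ltW.
  have [s_lt|s_ge] := ltP s 2^-1.
    apply: (@le_trans _ _ 0); last by rewrite addr_ge0.
    by rewrite pmulr_rle0 ?nmulr_rle0//; lra.
  apply: (@le_trans _ _ 1).
    (* The product [(s - 1/2) (7 - s)] is largest at 15/4, with value 169/16. *)
    have := sqr_ge0 (s - 15/4); lra.
  rewrite /f -natrD (ler_nat R 1) mxE.
  have : (L%:Z) ^+ 2 <= z ord0 ord0 ^+ 2.
    rewrite -(ler_int R) !rmorphXn /= -/(coord1 z).
    have : N%:R / 2 <= coord1 z ^+ 2.
      by move: s_ge; rewrite /s ler_pdivlMr// mulrC.
    move/(le_trans _); apply; rewrite ler_pdivlMr// mulrC.
    by rewrite -[(L%:Z)%:~R]/(L%:R) -natrX -natrM ler_nat.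
  rewrite -[X in _ <= X]real_normK ?num_real// ler_sqr ?nnegrE//.
  move: (z ord0 ord0) => a.
  by have [|] := boolP (L%:Z <= a); have [|] := boolP (L%:Z <= - a); lia.
apply: le_trans.
have -> : p = fun z => - (8 * 7 / 169) + (16 / 169 * (15 / 2) / N%:R * sqnorm z
  +
    (- (16 / 169) / N%:R ^+ 2) * coord1 z ^+ 4).
  by apply/funext => z; rewrite /p sqnorm1; field.
rewrite (iter_avgD N (fun=> _)) iter_avg_cst// iter_avgD !iter_avgZ.
rewrite iter_avg_sqnorm// iter_avg_coord4 sqnorm0 /coord1 mxE.
(* Under the walk, [s] has mean 1 and second moment [3 - 2 / N], so the average of [p] is
   [16/169 (1 + 2 / N)]. *)
rewrite -subr_ge0 (_ : _ - _ = 32 / 169 / N%:R).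
  by rewrite !mulr_ge0 ?invr_ge0.
by field.
Qed.

(** A nearest-neighbour walk on the line cannot be at or beyond [y] at time [N] without having
    visited [y]. The horizon [N.+1] accounts for the times 0 to [N]. *)
Lemma hit_prob1_ge N x y : x ord0 ord0 <= y ord0 ord0 ->
  iter N avg (fun z => (y ord0 ord0 <= z ord0 ord0)%R%:R) x <=
  hit_prob N.+1 y x :> R.
Proof.
elim: N x => [|N IHN] x xy.
  have [->|xy'] := eqVneq x y; first by rewrite /= eqxx lexx.
  apply: (@le_trans _ _ 0); last exact: hit_prob_ge0.
  rewrite /= (_ : (y ord0 ord0 <= _) = false)//; apply: contraNF xy' => yx.
  by apply/eqP/Zd_ext => i; rewrite (ord1 i); apply/le_anti/andP.
rewrite [hit_prob _ _ _]/=; case: eqVneq => [_|xy'].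
  apply: (@le_trans _ _ (iter N.+1 avg (fun=> 1) x)).
    by apply: iter_avg_le => z; rewrite lern1 leq_b1.
  by rewrite iter_avg_cst.
apply: avg_le => e; apply: IHN; rewrite step_coord.
have : x ord0 ord0 != y ord0 ord0.
  by apply: contraNneq xy' => xy'; apply/eqP/Zd_ext => i; rewrite (ord1 i).
by case: ifP => _; [case: ifP|]; lia.
Qed.

Lemma hit_probN N y x : hit_prob N (- y) (- x) = hit_prob N y x :> R.
Proof.
elim: N x => //= N IHN x; rewrite eqr_opp; case: ifP => // _.
have -> : hit_prob N y = (fun z => hit_prob N (- y) (- z)) :> (Zd 1 -> R).
  by apply/funext => z; rewrite IHN.
exact: esym (congr1 (fun f => f x) (iter_avg_symm 1 (hit_prob N (- y))
  negstep_inj stepN)).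
Qed.

Lemma hit_prob1_near L N x y : (0 < N)%N -> (2 * L ^ 2 <= N)%N ->
  (`|x ord0 ord0 - y ord0 ord0| <= L)%N -> 8 / 169 <= hit_prob N.+1 y x :> R.
Proof.
move=> N_gt0 LN.
wlog xy : x y / x ord0 ord0 <= y ord0 ord0.
  move=> wlg xyL; have [xy|yx] := leP (x ord0 ord0) (y ord0 ord0).
    exact: wlg.
  rewrite -hit_probN; apply: wlg; rewrite !mxE; first by rewrite lerN2 ltW.
  by move: xyL; rewrite distnC opprK addrC.
move=> xyL; apply: le_trans (hit_prob1_ge N xy).
apply: le_trans (walk1_displacement N_gt0 LN) _.
rewrite [leRHS]iter_avg_shift; apply: iter_avg_le => z.
rewrite ler_nat mxE.
move: xyL; move: (x ord0 ord0) (y ord0 ord0) (z ord0 ord0) => a b c.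
by case: (boolP (L%:Z <= c)); case: (boolP (b <= a + c)); lia.
Qed.

End OneDimension.

(** * Events of the frog model *)

Section Probability.
Context {R : realType} {disp : measure_display} {Omega : measurableType disp}.
Variable P : probability Omega R.
Implicit Types A B : set Omega.

Definition pr A : R := fine (P A).

Lemma prE A : measurable A -> (pr A)%:E = P A.
Proof. by move=> mA; rewrite fineK// fin_num_measure. Qed.

Lemma pr_EFin A r : P A = r%:E -> pr A = r.
Proof. by rewrite /pr => ->. Qed.

Lemma pr_ge0 A : 0 <= pr A.
Proof. exact: fine_ge0. Qed.

Lemma pr_le A B : measurable A -> measurable B -> A `<=` B -> pr A <= pr B.
Proof.
by move=> mA mB AB; rewrite -lee_fin !prE// le_measure ?inE.
Qed.

Lemma pr_setT : pr setT = 1.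
Proof. by rewrite /pr probability_setT. Qed.

Lemma pr_le1 A : measurable A -> pr A <= 1.
Proof. by move=> mA; rewrite -pr_setT pr_le. Qed.

Lemma pr_setU A B : measurable A -> measurable B -> A `&` B = set0 ->
  pr (A `|` B) = pr A + pr B.
Proof.
move=> mA mB AB; apply: EFin_inj; rewrite EFinD !prE//; last exact: measurableU.
exact: measureU.
Qed.

Lemma pr_setC A : measurable A -> pr (~` A) = 1 - pr A.
Proof.
move=> mA; apply/eqP; rewrite eq_sym subr_eq -pr_setU ?setUCl ?setICl
  ?pr_setT//.
exact: measurableC.
Qed.

Lemma pr_setU_le A B : measurable A -> measurable B ->
  pr (A `|` B) <= pr A + pr B.
Proof.
move=> mA mB; have -> : A `|` B = A `|` (B `\` A).
  by rewrite setDE setUIr setUCr setIT.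
rewrite pr_setU ?setDIK//; last exact: measurableD.
by rewrite lerD2l pr_le//; exact: measurableD.
Qed.

Lemma pr_bigsetU_le (I : Type) (s : seq I) (A : I -> set Omega) :
  (forall i, measurable (A i)) ->
  pr (\big[setU/set0]_(i <- s) A i) <= \sum_(i <- s) pr (A i).
Proof.
move=> mA; elim: s => [|i s IHs]; first by rewrite !big_nil (@pr_EFin set0 0)
  ?measure0.
rewrite !big_cons; apply: le_trans (pr_setU_le _ _) _ => //.
  exact: bigsetU_measurable.
by rewrite lerD2l.
Qed.

Lemma sum_pr_le (I : eqType) (s : seq I) (A : I -> set Omega) B : uniq s ->
  (forall i, measurable (A i)) -> measurable B ->
  (forall i j, i != j -> A i `&` A j = set0) ->
  (forall i, i \in s -> A i `<=` B) -> \sum_(i <- s) pr (A i) <= pr B.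
Proof.
move=> + mA + A_disj; elim: s B => [|i s IHs] B;
  first by rewrite big_nil pr_ge0.
rewrite big_cons => /andP[i_s s_uniq] mB AB.
have AiB : A i `<=` B by apply: AB; rewrite mem_head.
have mBA : measurable (B `\` A i) by exact: measurableD.
rewrite -[in leRHS](setDUK AiB) pr_setU// ?setDIK// lerD2l.
apply: IHs => // j js w Aj; split; first by apply: AB Aj; rewrite inE js orbT.
move=> Ai; have ij : i != j by apply: contraNneq i_s => ->.
by have : (A i `&` A j) w by []; rewrite A_disj.
Qed.

Lemma sigma_of_sub_measurable (I : Type) (disp' : measure_display)
    (T : measurableType disp') (X : I -> {mfun Omega >-> T}) (A : set Omega) :
  sigma_of (fun i => X i : Omega -> T) A -> measurable A.
Proof.
apply: smallest_sub; first exact: sigma_algebra_measurable.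
by move=> B [i _ [C mC <-]]; rewrite setTI; apply: measurable_funPTI.
Qed.

Lemma sigma_of_preimage (I : Type) (disp' : measure_display)
    (T : measurableType disp') (X : I -> Omega -> T) i (B : set T) :
  measurable B -> sigma_of X (X i @^-1` B).
Proof.
move=> mB; apply: sub_sigma_algebra; exists i => //.
by exists B => //; rewrite setTI.
Qed.

Lemma sigma_of_sub (I J : Type) (disp' : measure_display)
    (T : measurableType disp') (X : I -> Omega -> T) (f : J -> I) :
  sigma_of (fun j => X (f j)) `<=` sigma_of X.
Proof.
apply: sub_sigma_algebra2 => A [j _ Aj].
by exists (f j).
Qed.

Lemma sigma_ofT (I : Type) (disp' : measure_display)
    (T : measurableType disp') (X : I -> Omega -> T) : sigma_of X setT.
Proof. exact: (@measurableT _ (g_sigma_algebraType _)). Qed.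

Lemma sigma_ofC (I : Type) (disp' : measure_display)
    (T : measurableType disp') (X : I -> Omega -> T) A :
  sigma_of X A -> sigma_of X (~` A).
Proof. exact: (@measurableC _ (g_sigma_algebraType _)). Qed.

Lemma sigma_of_bigcap (I : Type) (disp' : measure_display)
    (T : measurableType disp') (X : I -> Omega -> T) (K : Type) (J : set K)
    (E : K -> set Omega) : finite_set J ->
  (forall i, J i -> sigma_of X (E i)) -> sigma_of X (\bigcap_(i in J) E i).
Proof. exact: (@fin_bigcap_measurable _ (g_sigma_algebraType _)). Qed.

Lemma sigma_of_bigcup (I : Type) (disp' : measure_display)
    (T : measurableType disp') (X : I -> Omega -> T) (E : nat -> set Omega) :
  (forall i, sigma_of X (E i)) -> sigma_of X (\bigcup_i E i).
Proof. exact: (@bigcupT_measurable _ (g_sigma_algebraType _)). Qed.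

End Probability.

(** * Events of single frogs and their independence *)

Section FrogProbability.
Context {R : realType} {d : nat}.
Hypothesis d_gt0 : (0 < d)%N.
Context {disp0 : measure_display} {Omega0 : measurableType disp0}.
Context {P0 : probability Omega0 R} {Xi : {RV P0 >-> nat}}.
Context {disp : measure_display} {Omega : measurableType disp}.
Context {P : probability Omega R}.
Variable F : frog_model d Xi P.
Implicit Types (x y z : Zd d) (s : seq (Zd d)).

Local Notation pr := (pr P).

Lemma measurable_walk x n (A : set (Zd d)) : measurable (walk F x n @^-1` A).
Proof. exact: measurable_funPTI. Qed.

Lemma measurable_lifetime x (A : set nat) : measurable (lifetime F x @^-1` A).
Proof. exact: measurable_funPTI. Qed.

Definition walk_prefix x s : set Omega :=
  [set w | forall i, (i <= size s)%N -> walk F x i w = nth x (x :: s) i].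

Lemma walk_prefixE x s : walk_prefix x s =
  \bigcap_(i in [set i | (i <= size s)%N]) walk F x i @^-1` [set nth x (x :: s)
    i].
Proof. by apply/seteqP; split. Qed.

Lemma measurable_walk_prefix x s : measurable (walk_prefix x s).
Proof.
rewrite walk_prefixE; apply: bigcap_measurableType => i _.
exact: measurable_walk.
Qed.

Lemma pr_walk_prefix x s : path (@Zd_adj d) x s ->
  pr (walk_prefix x s) = (2 * d)%:R ^- size s.
Proof. by move=> xs; apply: pr_EFin; rewrite (walk_law F x s) xs. Qed.

Definition walk_hits x y m n : set Omega :=
  [set w | exists2 j, (m <= j < n)%N & walk F x j w = y].

Lemma walk_hitsE x y m n : walk_hits x y m n =
  \bigcup_(j in [set j | (m <= j < n)%N]) walk F x j @^-1` [set y].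
Proof. by apply/seteqP; split => w [j]; exists j. Qed.

Lemma measurable_walk_hits x y m n : measurable (walk_hits x y m n).
Proof.
rewrite walk_hitsE; apply: bigcup_measurable => i _; exact: measurable_walk.
Qed.

(** The recursion of [hit_prob] is matched with the finite-dimensional laws by extending the prefix
    one step at a time, which replaces the Markov property. The extensions by different steps are
    disjoint events. *)
Lemma pr_walk_hits_prefix x y N s : path (@Zd_adj d) x s ->
  (2 * d)%:R ^- size s * hit_prob N y (last x s) <=
  pr (walk_prefix x s `&` walk_hits x y (size s) (size s + N)).
Proof.
have mI u m n : measurable (walk_prefix x u `&` walk_hits x y m n).
  by apply: measurableI; [exact: measurable_walk_prefix|exact:
    measurable_walk_hits].
elim: N s => [|N IHN] s xs /=; first by rewrite mulr0 pr_ge0.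
have [xy|xy] := eqVneq.
  rewrite mulr1 -(pr_walk_prefix xs); apply: pr_le => //.
    exact: measurable_walk_prefix.
  move=> w ws; split=> //; exists (size s); first by rewrite leqnn addnS ltnS
    leq_addr.
  by rewrite ws// -[nth _ _ _]/(nth x (x :: s) (size (x :: s)).-1) nth_last /=
    xy.
rewrite /avg mulrA -invfM -exprSr mulr_sumr.
set B := _ `&` _.
pose A (e : 'I_d * bool) := walk_prefix x (rcons s (last x s + step e)) `&`
  walk_hits x y (size s).+1 ((size s).+1 + N).
have pre_last e w : A e w -> walk F x (size s).+1 w = last x s + step e.
  move=> [ws _]; rewrite ws ?size_rcons//.
  by rewrite /= nth_rcons ltnn eqxx.
apply: (@le_trans _ _ (\sum_e pr (A e))).
  apply: ler_sum => e _; have := IHN (rcons s (last x s + step e)).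
  by rewrite size_rcons last_rcons; apply; rewrite rcons_path xs Zd_adj_step.
apply: sum_pr_le.
- exact: index_enum_uniq.
- by move=> e; exact: mI.
- exact: mI.
- move=> e e' ee'; apply/seteqP; split=> // w [/pre_last ew /pre_last e'w].
  by case/eqP: ee'; apply/step_inj/(addrI (last x s)); rewrite -ew.
- move=> e _ w [ws [j /andP[sj jN] wj]]; split.
    move=> i i_s; rewrite ws ?size_rcons 1?leqW// -rcons_cons nth_rcons /= ltnS
      i_s.
    by [].
  by exists j => //; lia.
Qed.

Lemma pr_walk_hits x y N : hit_prob N y x <= pr (walk_hits x y 0 N).
Proof.
have := @pr_walk_hits_prefix x y N [::] isT; rewrite invr1 mul1r => /le_trans;
  apply.
apply: pr_le; last by move=> w [].
- by apply: measurableI; [exact: measurable_walk_prefix|exact: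
  measurable_walk_hits].
- exact: measurable_walk_hits.
Qed.

(** The exceptional set is a countable union, over encoded sites and finite sequences, of null
    events: a wrong starting point ([C]) or a prefix that is not a nearest-neighbour path ([B]). *)
Lemma walk_nearest_neighbour_ae : exists2 Z : set Omega,
  measurable Z /\ P Z = 0%E &
  forall w, ~ Z w -> forall x n,
    walk F x 0 w = x /\ Zd_adj (walk F x n w) (walk F x n.+1 w).
Proof.
pose C (n : nat) : set Omega :=
  if choice.unpickle n is Some x then ~` walk_prefix x [::] else set0.
pose B (n : nat) : set Omega :=
  if choice.unpickle n is Some (x, s) then
    if path (@Zd_adj d) x s then set0 else walk_prefix x s
  else set0.
have C0 : P.-negligible (\bigcup_n C n).
  apply: negligible_bigcup => n; rewrite /C; case: choice.unpickle => [x|];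
    last first.
    exact: negligible_set0.
  have mx := measurable_walk_prefix x [::]; have mxC := measurableC mx.
  apply/negligibleP => //.
  apply: etrans (esym (prE P mxC)) _.
  by rewrite pr_setC// pr_walk_prefix// invr1 subrr.
have B0 : P.-negligible (\bigcup_n B n).
  apply: negligible_bigcup => n; rewrite /B.
  case: choice.unpickle => [[x s]|]; last exact: negligible_set0.
  have [_|xs] := ifPn; first exact: negligible_set0.
  apply/negligibleP; first exact: measurable_walk_prefix.
  by apply: etrans (walk_law F x s) _; rewrite (negPf xs).
have [Z [mZ Z0 CBZ]] := negligibleU C0 B0.
exists Z => // w Zw x n.
have x0 : walk F x 0 w = x.
  apply: contrapT => wx; apply/Zw/CBZ; left; exists (choice.pickle x) => //.
  by rewrite /C choice.pickleK => /(_ 0%N isT).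
split=> //.
pose s := [seq walk F x i.+1 w | i <- iota 0 n.+1].
have ss : size s = n.+1 by rewrite size_map size_iota.
have nth_s i : (i <= n.+1)%N -> nth x (x :: s) i = walk F x i w.
  case: i => [|i] /=; first by rewrite x0.
  by move=> lt_in; rewrite (nth_map 0%N) ?size_iota// nth_iota.
have /(pathP x) xs : path (@Zd_adj d) x s.
  apply/negP => /negP xs; apply/Zw/CBZ; right; exists (choice.pickle (x, s)) =>
    //.
  by rewrite /B choice.pickleK (negPf xs) => i; rewrite ss => /nth_s ->.
have := xs n; rewrite ss nth_s// => /(_ (leqnn _)).
by rewrite -[nth x s n]/(nth x (x :: s) n.+1) nth_s.
Qed.

(* The lifetime of y decides whether its walk matters, which moves y from the
   list J of undecided sites to the set K of decided ones. *)
Lemma independent_failure (L W : Zd d -> set Omega) (J : seq (Zd d))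
    (K : {fset Zd d}) (a b : Zd d -> set Omega) :
  (forall x, sigma_of (fun _ : unit => lifetime F x : Omega -> nat) (L x)) ->
  (forall x, sigma_of (fun n => walk F x n : Omega -> Zd d) (W x)) ->
  (forall x, sigma_of (fun _ : unit => lifetime F x : Omega -> nat) (a x)) ->
  (forall x, sigma_of (fun n => walk F x n : Omega -> Zd d) (b x)) ->
  uniq J -> (forall x, x \in J -> x \notin K) ->
  pr ([set w | forall x, x \in K -> a x w /\ b x w] `&`
      [set w | forall x, x \in J -> ~ (L x w /\ W x w)]) =
  (\prod_(x <- K) (pr (a x) * pr (b x))) *
  \prod_(x <- J) (1 - pr (L x) * pr (W x)).
Proof.
move=> sL sW.
have mL x A : sigma_of (fun _ : unit => lifetime F x : Omega -> nat) A ->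
  measurable A by exact: (sigma_of_sub_measurable (X := fun=> lifetime F x)).
have mW x A : sigma_of (fun n => walk F x n : Omega -> Zd d) A ->
  measurable A by exact: (sigma_of_sub_measurable (X := walk F x)).
have mK (K' : {fset Zd d}) (a' b' : Zd d -> set Omega) :
    (forall x, measurable (a' x)) -> (forall x, measurable (b' x)) ->
    measurable [set w | forall x, x \in K' -> a' x w /\ b' x w].
  move=> ma mb; rewrite [X in measurable X](_ : _ =
      \bigcap_(x in [set` K']) (a' x `&` b' x)); last by apply/seteqP;
        split=> w wK x /wK.
  by apply: fin_bigcap_measurable => // x _; apply: measurableI.
have mJ (J' : seq (Zd d)) :
    measurable [set w | forall x, x \in J' -> ~ (L x w /\ W x w)].
  rewrite [X in measurable X](_ : _ =
      \bigcap_(x in [set` J']) ~` (L x `&` W x)); last by apply/seteqP;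
        split=> w wK x /wK.
  apply: fin_bigcap_measurable => // x _; apply/measurableC/measurableI.
    exact: mL (sL x).
  exact: mW (sW x).
elim: J K a b => [|y J IHJ] K a b sa sb.
  move=> _ _; rewrite big_nil mulr1.
  pose A := \bigcap_(x in [set` K]) a x.
  pose B := \bigcap_(x in [set` K]) b x.
  have mA : measurable A.
    by apply: fin_bigcap_measurable => // x _; apply: mL (sa x).
  have mB : measurable B.
    by apply: fin_bigcap_measurable => // x _; apply: mW (sb x).
  have -> : [set w | forall x, x \in K -> a x w /\ b x w] `&`
      [set w | forall x, x \in [::] -> ~ (L x w /\ W x w)] = A `&` B.
    apply/seteqP; split=> w [wA wB].
      by split=> x xK; have [] := wA x xK.
    by split=> // x xK; split; [exact: wA | exact: wB].
  (* Lifetimes are first separated from walks; each family then factorises over the sites. *)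
  have AB : pr (A `&` B) = pr A * pr B.
    apply: EFin_inj; rewrite EFinM !prE//; last exact: measurableI.
    refine (@lifetime_walk_indep _ _ _ _ _ _ _ _ _ F A B _ _).
      apply: sigma_of_bigcap => // x _.
      exact: (sigma_of_sub (X := fun z => lifetime F z : Omega -> nat)
        (f := fun _ : unit => x) (sa x)).
    apply: sigma_of_bigcap => // x _.
    exact: (sigma_of_sub (X := fun xn : Zd d * nat => walk F xn.1 xn.2
      : Omega -> Zd d) (f := pair x) (sb x)).
  rewrite AB big_split /=; congr (_ * _); apply: EFin_inj; rewrite prE//.
    refine (etrans (@lifetime_indep _ _ _ _ _ _ _ _ _ F K a (fun x _ => sa x))
      _).
    rewrite -prodEFin; apply: eq_bigr => x _; rewrite prE//.
    exact: mL (sa x).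
  refine (etrans (@walk_indep _ _ _ _ _ _ _ _ _ F K b (fun x _ => sb x)) _).
  rewrite -prodEFin; apply: eq_bigr => x _; rewrite prE//.
  exact: mW (sb x).
move=> /= /andP[yJ uJ] JK.
have yK : y \notin K by apply: JK; rewrite mem_head.
pose upd (c : Zd d -> set Omega) A := fun x => if x == y then A else c x.
have updK c A : {in K, upd c A =1 c}.
  by move=> x xK; rewrite /upd; case: eqVneq xK yK => // -> ->.
have supd (G : Zd d -> set_system Omega) c A : (forall x, G x (c x)) ->
    G y A -> forall x, G x (upd c A x).
  by move=> Gc GA x; rewrite /upd; case: eqVneq => // ->.
have JK' x : x \in J -> x \notin (y |` K)%fset.
  move=> xJ; rewrite !inE negb_or JK ?inE ?xJ ?orbT// andbT.
  by apply: contraNneq yJ => <-.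
(* The failure at [y] splits into two disjoint cases: the lifetime fails and the walk is free, or
   the lifetime succeeds and the walk fails. Their probabilities add up to
   [1 - pr (L y) * pr (W y)]. *)
pose a1 := upd a (~` L y); pose b1 := upd b setT.
pose a2 := upd a (L y); pose b2 := upd b (~` W y).
pose SL x := sigma_of (fun _ : unit => lifetime F x : Omega -> nat).
pose SW x := sigma_of (fun n => walk F x n : Omega -> Zd d).
have sWT : SW y setT by exact: sigma_ofT.
have sa1 := supd SL _ _ sa (sigma_ofC (sL y)).
have sa2 := supd SL _ _ sa (sL y).
have sb1 := supd SW _ _ sb sWT.
have sb2 := supd SW _ _ sb (sigma_ofC (sW y)).
have E1 := IHJ (y |` K)%fset a1 b1 sa1 sb1 uJ JK'.
have E2 := IHJ (y |` K)%fset a2 b2 sa2 sb2 uJ JK'.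
have mL' x := mL x _ (sL x); have mW' x := mW x _ (sW x).
have prodK c1 c2 A1 A2 : \prod_(x <- (y |` K)%fset) (pr (upd c1 A1 x) * pr (upd
  c2 A2 x))
    = pr A1 * pr A2 * \prod_(x <- K) (pr (c1 x) * pr (c2 x)).
  rewrite big_fsetU1//= {1 2}/upd eqxx; congr (_ * _).
  by apply: eq_big_seq => x xK; rewrite !updK.
rewrite [X in pr X](_ : _ =
  ([set w | forall x, x \in (y |` K)%fset -> a1 x w /\ b1 x w] `&`
      [set w | forall x, x \in J -> ~ (L x w /\ W x w)]) `|`
  ([set w | forall x, x \in (y |` K)%fset -> a2 x w /\ b2 x w] `&`
      [set w | forall x, x \in J -> ~ (L x w /\ W x w)])); last first.
  have upd_in c1 c2 A1 A2 w : (forall x, x \in K -> c1 x w /\ c2 x w) ->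
      A1 w -> A2 w -> forall x, x \in (y |` K)%fset ->
      upd c1 A1 x w /\ upd c2 A2 x w.
    move=> wc wA1 wA2 x; rewrite !inE /upd; case: eqVneq => //= _.
    exact: wc.
  have in_upd c1 c2 A1 A2 w : (forall x, x \in (y |` K)%fset ->
      upd c1 A1 x w /\ upd c2 A2 x w) ->
      (forall x, x \in K -> c1 x w /\ c2 x w) /\ A1 w /\ A2 w.
    move=> wc; split=> [x xK|].
      by have := wc x; rewrite !updK// !inE xK orbT; apply.
    by have := wc y; rewrite /upd eqxx !inE eqxx; apply.
  apply/seteqP; split=> w.
    move=> [wK wJ].
    have wJ' x : x \in J -> ~ (L x w /\ W x w).
      by move=> xJ; apply: wJ; rewrite inE xJ orbT.
    have := wJ y (mem_head _ _).
    have [wL|wL] := pselect (L y w); last first.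
      by move=> _; left; split=> //; apply: upd_in.
    move=> wW; right; split=> //; apply: upd_in => // Wy; exact: wW.
  move=> [] [/in_upd[wK [wA wB]] wJ]; split=> // x; rewrite inE.
    by move=> /predU1P[->[]//|/wJ].
  by move=> /predU1P[->[]//|/wJ].
rewrite pr_setU; first last.
- apply/seteqP; split=> // w [[w1 _] [w2 _]].
  have := w1 y; have := w2 y; rewrite /a1 /a2 /upd eqxx !inE eqxx /=.
  by move=> /(_ isT)[? _] /(_ isT)[].
- apply: measurableI => //; apply: mK => x; [exact: mL (sa2 x)|exact: mW (sb2
  x)].
- apply: measurableI => //; apply: mK => x; [exact: mL (sa1 x)|exact: mW (sb1
  x)].
rewrite E1 E2 !prodK !pr_setC// pr_setT big_cons.
by ring.
Qed.

End FrogProbability.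

(** * Activation times *)

Section NatInfimum.
Context {R : realType}.
Local Open Scope ereal_scope.

Definition nat_or_infty (t : \bar R) : Prop :=
  t = +oo \/ exists n : nat, t = n%:R%:E.

Lemma nat_or_inftyD s t :
  nat_or_infty s -> nat_or_infty t -> nat_or_infty (s + t).
Proof.
move=> [->|[m ->]] [->|[n ->]]; [by left..|right].
by exists (m + n)%N; rewrite natrD EFinD.
Qed.

Lemma nat_or_infty_leP t (k : nat) : nat_or_infty t ->
  t <= k%:R%:E -> exists2 n : nat, (n <= k)%N & t = n%:R%:E.
Proof.
move=> [->|[n ->]]; first by rewrite leye_eq.
by rewrite lee_fin ler_nat => nk; exists n.
Qed.

(** An infimum of such values is attained as soon as it is finite, by well-ordering; hence bounds on
    [T(x)] and [t(x, y)] have witnesses. *)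
Lemma ereal_inf_nat (T : set (\bar R)) : T `<=` nat_or_infty ->
  nat_or_infty (ereal_inf T) /\
  forall k : nat, ereal_inf T <= k%:R%:E <-> exists2 t, T t & t <= k%:R%:E.
Proof.
move=> natT.
have [[t0 Tt0 t0_fin]|noT] := pselect (exists2 t, T t & exists n : nat, t =
  n%:R%:E).
  have exn : exists n : nat, `[< T n%:R%:E >].
    by case: t0_fin => n nE; exists n; apply/asboolP; rewrite -nE.
  case: (ex_minnP exn) => m /asboolP Tm m_min.
  have -> : ereal_inf T = m%:R%:E.
    apply/eqP; rewrite eq_le ereal_inf_lbound//=.
    apply: le_ereal_inf_tmp => t Tt; case: (natT _ Tt) => [->|[n tE]].
      exact: leey.
    by rewrite tE lee_fin ler_nat m_min//; apply/asboolP; rewrite -tE.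
  split; first by right; exists m.
  move=> k; split=> [mk|[t Tt tk]]; first by exists m%:R%:E.
  have [n _ tE] := nat_or_infty_leP (natT _ Tt) tk.
  by apply: le_trans tk; rewrite tE lee_fin ler_nat m_min//; apply/asboolP;
    rewrite -tE.
have T_infty t : T t -> t = +oo.
  by move=> Tt; case: (natT _ Tt) => // tn; case: noT; exists t.
have -> : ereal_inf T = +oo.
  apply/eqP; rewrite -leye_eq; apply: le_ereal_inf_tmp => t /T_infty ->.
  exact: lexx.
split; first by left.
by move=> k; rewrite leye_eq; split=> // -[t /T_infty ->]; rewrite leye_eq.
Qed.

End NatInfimum.

Section Activation.
Context {R : realType} {d : nat}.
Context {disp0 : measure_display} {Omega0 : measurableType disp0}.
Context {P0 : probability Omega0 R} {Xi : {RV P0 >-> nat}}.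
Context {disp : measure_display} {Omega : measurableType disp}.
Context {P : probability Omega R}.
Variable F : frog_model d Xi P.
Implicit Types (x y z : Zd d) (s : seq (Zd d)) (w : Omega) (k n : nat).
Local Open Scope ereal_scope.

Let hitting_times_nat w x y :
  [set n%:R%:E | n in [set n : nat | (n < lifetime F x w)%N /\ walk F x n w =
    y]]
  `<=` @nat_or_infty R.
Proof. by move=> _ [n _ <-]; right; exists n. Qed.

Lemma hitting_time_nat w x y : nat_or_infty (hitting_time F w x y).
Proof. by have [] := ereal_inf_nat (@hitting_times_nat w x y). Qed.

Lemma hitting_time_leP w x y k : hitting_time F w x y <= k%:R%:E <->
  exists n, [/\ (n <= k)%N, (n < lifetime F x w)%N & walk F x n w = y].
Proof.
have [_ ->] := ereal_inf_nat (@hitting_times_nat w x y).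
split=> [[_ [n [nl nw] <-]]|[n [nk nl nw]]].
  by rewrite lee_fin ler_nat; exists n.
by exists n%:R%:E; [exists n|rewrite lee_fin ler_nat].
Qed.

Lemma passage_time_nat w x s : nat_or_infty (passage_time F w x s).
Proof.
elim: s x => [|y s IHs] x /=; first by right; exists 0%N.
exact: nat_or_inftyD (hitting_time_nat _ _ _) _.
Qed.

Lemma activation_time_nat w x : nat_or_infty (activation_time F w x).
Proof.
by apply: (ereal_inf_nat _).1 => _ [s _ <-]; exact: passage_time_nat.
Qed.

Lemma activation_time_leP w x k : activation_time F w x <= k%:R%:E <->
  exists2 s, path (fun y z => y != z) 0%R s /\ last 0%R s = x &
    passage_time F w 0%R s <= k%:R%:E.
Proof.
rewrite (ereal_inf_nat _).2 => [|_ [s _ <-]]; last exact: passage_time_nat.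
split=> [[_ [s sx <-] sk]|[s sx sk]]; first by exists s.
by exists (passage_time F w 0%R s) => //; exists s.
Qed.

Lemma passage_time_rcons w x s y : passage_time F w x (rcons s y) =
  passage_time F w x s + hitting_time F w (last x s) y.
Proof.
elim: s x => [|z s IHs] x /=; first by rewrite addeC.
by rewrite IHs addeA.
Qed.

Definition activated w x := exists k : nat, activation_time F w x = k%:R%:E.

Lemma activatedP w x k : activation_time F w x <= k%:R%:E -> activated w x.
Proof.
move=> /(nat_or_infty_leP (activation_time_nat _ _))[n _ xn].
by exists n.
Qed.

Lemma activated0 w : activated w 0%R.
Proof. by apply/(@activatedP _ _ 0%N)/activation_time_leP; exists [::]. Qed.

(** The visited site is appended to a sequence leading to [x]. A visit to [x] itself is treated
    apart, since consecutive terms of the sequences must differ. *)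
Lemma activated_visit w x j : activated w x -> (j < lifetime F x w)%N ->
  activated w (walk F x j w).
Proof.
move=> [k xk] jl; have [->//|xy] := eqVneq (walk F x j w) x.
  by exists k.
have /activation_time_leP[s [s_path s_last] sk] : activation_time F w x <=
  k%:R%:E.
  by rewrite xk.
apply/(@activatedP _ _ (k + j)%N)/activation_time_leP.
exists (rcons s (walk F x j w)).
  by rewrite rcons_path last_rcons s_path s_last eq_sym xy.
rewrite passage_time_rcons s_last natrD EFinD leeD//.
by apply/hitting_time_leP; exists j.
Qed.

Lemma dist1_triangle x y z : (dist1 x z <= dist1 x y + dist1 y z)%N.
Proof.
rewrite /dist1 -big_split /=; apply: leq_sum => i _.
move: (x ord0 i) (y ord0 i) (z ord0 i) => a b c; lia.
Qed.

Lemma dist1_adj x y : Zd_adj x y -> dist1 x y = 1%N.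
Proof. by move=> /eqP. Qed.

Definition nearest_neighbour w := forall x n,
  walk F x 0 w = x /\ Zd_adj (walk F x n w) (walk F x n.+1 w).

Lemma nearest_neighbour_dist1 w x n : nearest_neighbour w ->
  (dist1 x (walk F x n w) <= n)%N.
Proof.
move=> nn; elim: n => [|n IHn].
  by have [-> _] := nn x 0%N; rewrite leqn0 dist1_eq0.
apply: leq_trans (dist1_triangle _ (walk F x n w) _) _.
by rewrite (dist1_adj (nn x n).2) addn1 ltnS.
Qed.

(** Every frog moves at speed at most 1, hence so does activation along any sequence, by the
    triangle inequality. *)
Lemma activation_time_dist1 w x k : nearest_neighbour w ->
  activation_time F w x = k%:R%:E -> (dist1 0%R x <= k)%N.
Proof.
move=> nn xk.
have /activation_time_leP[s [_ <-]] : activation_time F w x <= k%:R%:E by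
  rewrite xk.
elim: s 0%R k {x xk} => [|y s IHs] x k /=.
  by have /eqP -> : dist1 x x == 0%N by rewrite dist1_eq0.
case: (hitting_time_nat w x y) => [->|[m xym]].
  have [->|[n ->]] := passage_time_nat w y s.
    by rewrite addye// leye_eq.
  by rewrite addye// leye_eq.
rewrite xym; case: (passage_time_nat w y s) => [->|[n ysn]].
  by rewrite addey// leye_eq.
rewrite ysn -EFinD -natrD lee_fin ler_nat => mnk.
apply: leq_trans mnk; apply: leq_trans (dist1_triangle _ y _) _.
apply: leq_add; last by apply: IHs; rewrite ysn.
have /hitting_time_leP[m' [m'm _ <-]] : hitting_time F w x y <= m%:R%:E.
  by rewrite xym.
exact: leq_trans (nearest_neighbour_dist1 _ _ nn) m'm.
Qed.

(** * Measurability of the activation and root-hitting events *)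

Lemma measurable_hitting_time_le x y k :
  measurable [set w | hitting_time F w x y <= k%:R%:E].
Proof.
rewrite [X in measurable X](_ : _ = \bigcup_(n in [set n | (n <= k)%N])
    (lifetime F x @^-1` [set l | (n < l)%N] `&` walk F x n @^-1` [set y])).
  apply: bigcup_measurable => n _; apply: measurableI.
    exact: measurable_lifetime.
  exact: measurable_walk.
apply/seteqP; split=> w; first by move=> /hitting_time_leP[n [nk nl nw]];
  exists n.
by move=> [n nk [nl nw]]; apply/hitting_time_leP; exists n.
Qed.

Lemma measurable_passage_time_le x s k :
  measurable [set w | passage_time F w x s <= k%:R%:E].
Proof.
elim: s x k => [|y s IHs] x k /=.
  by rewrite lee_fin ler0n; rewrite [X in measurable X](_ : _ = setT) ?set_true.
rewrite [X in measurable X](_ : _ = \bigcup_(n in [set n | (n <= k)%N])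
   ([set w | hitting_time F w x y <= n%:R%:E] `&`
    [set w | passage_time F w y s <= (k - n)%:R%:E])).
  apply: bigcup_measurable => n _; apply: measurableI => //.
  exact: measurable_hitting_time_le.
apply/seteqP; split=> w /=.
  move=> xsk; have := xsk.
  have [->|[m xym]] := hitting_time_nat w x y.
    by have [->|[n ->]] := passage_time_nat w y s; rewrite addye// leye_eq.
  have [->|[n ysn]] := passage_time_nat w y s.
    by rewrite xym addey// leye_eq.
  rewrite xym ysn -EFinD -natrD lee_fin ler_nat => mnk.
  exists m => /=; first by apply: leq_trans mnk; rewrite leq_addr.
  by rewrite xym ysn; split=> //; rewrite lee_fin ler_nat; lia.
move=> [n /= nk [xyn ysn]].
by rewrite -(subnKC nk) natrD EFinD leeD.
Qed.

Lemma measurable_activation_time_le x k :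
  measurable [set w | activation_time F w x <= k%:R%:E].
Proof.
rewrite [X in measurable X](_ : _ = \bigcup_s
  (if path (fun y z => y != z) 0%R s && (last 0%R s == x) then
   [set w | passage_time F w 0%R s <= k%:R%:E] else set0)).
  apply: countable_bigcupT_measurable => // s; case: ifP => // _.
  exact: measurable_passage_time_le.
apply/seteqP; split=> w /=.
  by move=> /activation_time_leP[s [sp sl] sk]; exists s => //;
    rewrite sp sl eqxx.
move=> [s _]; case: ifP => // /andP[sp /eqP sl] sk.
by apply/activation_time_leP; exists s.
Qed.

Lemma measurable_activation_time_eq x k :
  measurable [set w | activation_time F w x = k%:R%:E].
Proof.
rewrite [X in measurable X](_ : _ =
  [set w | activation_time F w x <= k%:R%:E] `&`
  if k is k'.+1 then ~` [set w | activation_time F w x <= k'%:R%:E] else setT).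
  apply: measurableI; first exact: measurable_activation_time_le.
  by case: k => // k; apply/measurableC/measurable_activation_time_le.
apply/seteqP; split=> w /=.
  move=> xk; split; first by rewrite xk.
  by case: k xk => // k xk; rewrite /setC /= xk lee_fin ler_nat ltnn.
move=> [/(nat_or_infty_leP (activation_time_nat _ _))[n nk xn]].
case: k nk => [|k] nk; first by move: nk; rewrite xn leqn0 => /eqP ->.
move=> xk; rewrite xn; congr (_%:R%:E); apply/eqP; rewrite eqn_leq nk ltnNge.
by apply/negP => nk'; apply: xk; rewrite /= xn lee_fin ler_nat.
Qed.

Lemma measurable_root_hit_at n : measurable [set w | root_hit_at F w n].
Proof.
rewrite [X in measurable X](_ : _ = \bigcup_x \bigcup_k \bigcup_j
  ([set w | activation_time F w x = k%:R%:E] `&`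
   (lifetime F x @^-1` [set l | (j < l)%N] `&` walk F x j @^-1` [set 0%R]) `&`
   [set _ | n = (k + j)%N])).
  apply: countable_bigcupT_measurable => // x.
  apply: bigcupT_measurable => k; apply: bigcupT_measurable => j.
  apply: measurableI; first apply: measurableI.
  - exact: measurable_activation_time_eq.
  - apply: measurableI; first exact: measurable_lifetime.
    exact: measurable_walk.
  - have [->|nkj] := eqVneq n (k + j)%N.
      by rewrite [X in measurable X](_ : _ = setT)//; apply/seteqP.
    rewrite [X in measurable X](_ : _ = set0)//; apply/seteqP;
      split=> // w /= nkj'.
    by rewrite nkj' eqxx in nkj.
apply/seteqP; split=> w.
  by move=> [x [k [j [? ? ? ?]]]]; exists x => //; exists k => //; exists j.
by move=> [x _ [k _ [j _ [[? [? ?]] ?]]]]; exists x, k, j.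
Qed.

Lemma measurable_root_hit_infinitely_often :
  measurable (root_hit_infinitely_often F).
Proof.
rewrite (_ : root_hit_infinitely_often F = \bigcap_m \bigcup_n
  ([set w | root_hit_at F w n] `&` [set _ | (m <= n)%N])).
  apply: bigcapT_measurable => m; apply: bigcupT_measurable => n.
  apply: measurableI; first exact: measurable_root_hit_at.
  have [mn|mn] := boolP (m <= n)%N.
    by rewrite [X in measurable X](_ : _ = setT)//; apply/seteqP.
  by rewrite [X in measurable X](_ : _ = set0)//; apply/seteqP; split.
apply/seteqP; split=> w.
  move=> inf_w m _; apply: contrapT => no_n; apply: inf_w.
  apply: (sub_finite_set _ (finite_II m)) => n /= n_hit.
  by rewrite ltnNge; apply/negP => mn; apply: no_n; exists n.
move=> w_hit /finite_fsetP[X XE].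
have [n _ [n_hit]] := w_hit (\max_(i <- X) i).+1 I.
have : [set n | root_hit_at F w n] n by [].
rewrite XE /= => nX; rewrite ltnNge; apply/negP/negPn.
exact: leq_bigmax_seq.
Qed.

End Activation.

(** * Recurrence by multiscale activation *)

(** This provides the route along which the frog of the origin visits the whole initial box. *)
Lemma Zd_path_cover {d : nat} (x : Zd d) (l : seq (Zd d)) :
  exists2 s, path (@Zd_adj d) x s & {subset l <= x :: s}.
Proof.
elim: l x => [|z l IHl] x; first by exists [::].
have [s1 xs1 [zs1 _]] := Zd_path_ex x z.
have [s2 zs2 ls2] := IHl z.
exists (s1 ++ s2); first by rewrite cat_path xs1 zs1.
have zin : z \in x :: s1 by rewrite -zs1 mem_last.
move=> y; rewrite -cat_cons mem_cat inE => /predU1P[->|/ls2];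
  first by rewrite zin.
by rewrite inE => /predU1P[->|->]; rewrite ?zin ?orbT.
Qed.

Section Criterion.
Context {R : realType} {d : nat}.
Hypothesis d_gt0 : (0 < d)%N.
Context {disp0 : measure_display} {Omega0 : measurableType disp0}.
Context {P0 : probability Omega0 R} {Xi : {RV P0 >-> nat}}.
Context {disp : measure_display} {Omega : measurableType disp}.
Context {P : probability Omega R}.
Variable F : frog_model d Xi P.
Variables (site target : nat -> seq (Zd d)) (N : nat -> nat).
Implicit Types (x y z : Zd d) (w : Omega) (k n : nat).

(* Walks from the sites of site k to all the sites of target k cover
   site k.+1. *)
Definition target_covers : Prop := forall k z, z \in site k.+1 ->
  z \in site k \/ exists2 y, y \in target k &
    forall (f : nat -> Zd d) j, f 0%N \in site k ->
      (forall i, Zd_adj (f i) (f i.+1)) -> f j = y ->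
      exists2 i, (i <= j)%N & f i = z.

Hypothesis covers : target_covers.
Hypothesis target0 : forall k, 0 \in target k.
Hypothesis N_ge : forall k, (k <= N k)%N.
Hypothesis site_uniq : forall k, uniq (site k).

(** The condition [x != 0] sets the frog of the origin aside, so that its initial trajectory can be
    imposed independently. *)
Definition success k w := forall y, y \in target k -> exists x,
  [/\ x \in site k, x != 0, (N k <= lifetime F x w)%N &
      walk_hits F x y 0 (N k) w].

Lemma success_activated K w : nearest_neighbour F w ->
  (forall x, x \in site K -> activated F w x) ->
  (forall k, (K <= k)%N -> success k w) ->
  forall k x, (K <= k)%N -> x \in site k -> activated F w x.
Proof.
move=> nn actK succ k x /subnKC <-; move: (k - K)%N => {}k.
elim: k x => [|k IHk] x; first by rewrite addn0; exact: actK.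
rewrite addnS => /covers[/IHk//|[y yk fP]].
have [z [zk _ zl [j /andP[_ jN] zj]]] := succ _ (leq_addr k K) _ yk.
have [|i|i ij <-] := fP (fun i => walk F z i w) j _ _ zj.
- by rewrite (nn z 0%N).1.
- exact: (nn z i).2.
apply: activated_visit; first exact: IHk.
by apply: leq_trans zl; apply: leq_ltn_trans jN.
Qed.

Lemma dist1_box x n : (dist1 0%R x <= n)%N -> x \in box n.
Proof.
move=> xn; rewrite mem_box; apply/forallP => i; apply: leq_trans xn.
by rewrite /dist1 (bigD1 i)//= mxE sub0r abszN leq_addr.
Qed.

(** If all hits occurred by time [M], every frog hitting 0 would be activated by time [M], hence
    come from the finite [box M], and its lifetime would be at most some [B]. Success at a scale
    beyond [B] contradicts this. *)
Lemma success_root_hit K w : nearest_neighbour F w ->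
  (forall x, x \in site K -> activated F w x) ->
  (forall k, (K <= k)%N -> success k w) ->
  root_hit_infinitely_often F w.
Proof.
move=> nn actK succ /finite_fsetP[X XE].
pose M := (\max_(n <- X) n)%N.
have hit_le n : root_hit_at F w n -> (n <= M)%N.
  move=> hn; have : [set n | root_hit_at F w n] n by [].
  by rewrite XE /= => nX; apply: leq_bigmax_seq.
pose B := (\max_(x <- box M) lifetime F x w)%N.
(* At this scale the required lifetime [N k >= k] exceeds [B]. *)
pose k := (K + B.+1)%N.
have Kk : (K <= k)%N by rewrite leq_addr.
have [x [xk _ xl [j /andP[_ jN] xj]]] := succ k Kk 0 (target0 k).
have [a xa] := success_activated nn actK succ Kk xk.
have haj : root_hit_at F w (a + j).
  by exists x, a, j; split=> //; apply: leq_trans xl.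
have xM : x \in box M.
  apply: dist1_box; apply: leq_trans (activation_time_dist1 nn xa) _.
  by apply: leq_trans (hit_le _ haj); rewrite leq_addr.
have : (lifetime F x w <= B)%N by apply: leq_bigmax_seq.
by move: xl (N_ge k); rewrite /k; lia.
Qed.

(** * Probabilities of the start and failure events *)

Definition tail_prob n : R := pr P0 [set u | (n <= Xi u)%N].

Lemma pr_lifetime x (A : set nat) : pr P (lifetime F x @^-1` A) = pr P0 (Xi
  @^-1` A).
Proof. by rewrite /pr -[P _]/(distribution P (lifetime F x) A) lifetime_law.
  Qed.

Lemma tail_prob_ge0 n : 0 <= tail_prob n. Proof. exact: pr_ge0. Qed.

Lemma tail_prob_le1 n : tail_prob n <= 1.
Proof.
apply: pr_le1; rewrite -[X in measurable X]/(Xi @^-1` [set l | (n <= l)%N]).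
exact: measurable_funPTI.
Qed.

Definition failure k y : set Omega :=
  [set w | forall x, x \in [seq x <- site k | x != 0] ->
    ~ ((lifetime F x @^-1` [set l | (N k <= l)%N]) w /\
       walk_hits F x y 0 (N k) w)].

(* The quantification over a singleton matches independent_failure. *)
Definition start (s : seq (Zd d)) : set Omega :=
  [set w | forall x, x \in [fset (0 : Zd d)]%fset ->
    (lifetime F x @^-1` [set l | (size s < l)%N]) w /\ walk_prefix F x s w].

Lemma sigma_lifetime x (A : set nat) :
  sigma_of (fun _ : unit => lifetime F x : Omega -> nat) (lifetime F x @^-1` A).
Proof. exact: (sigma_of_preimage (X := fun=> lifetime F x) tt). Qed.

Lemma sigma_walk_prefix x s :
  sigma_of (fun n => walk F x n : Omega -> Zd d) (walk_prefix F x s).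
Proof.
rewrite walk_prefixE; apply: sigma_of_bigcap => [|i _].
  by apply: (sub_finite_set _ (finite_II (size s).+1)) => i.
exact: (sigma_of_preimage (X := fun n => walk F x n : Omega -> Zd d) i).
Qed.

Lemma sigma_walk_hits x y m n :
  sigma_of (fun n => walk F x n : Omega -> Zd d) (walk_hits F x y m n).
Proof.
rewrite walk_hitsE bigcup_mkcond.
apply: sigma_of_bigcup => j; case: ifP => _.
  exact: (sigma_of_preimage (X := fun n => walk F x n : Omega -> Zd d) j).
rewrite -(setCT); apply: sigma_ofC; exact: sigma_ofT.
Qed.

Lemma measurable_start s : measurable (start s).
Proof.
rewrite [X in measurable X](_ : _ = \bigcap_(x in [set` [fset (0 : Zd d)]%fset])
  (lifetime F x @^-1` [set l | (size s < l)%N] `&` walk_prefix F x s)).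
  apply: fin_bigcap_measurable => // x _; apply: measurableI.
    exact: measurable_lifetime.
  exact: measurable_walk_prefix.
by apply/seteqP; split=> w wK x /wK.
Qed.

Lemma measurable_failure k y : measurable (failure k y).
Proof.
rewrite [X in measurable X](_ : _ =
  \bigcap_(x in [set` [seq x <- site k | x != 0]])
  ~` (lifetime F x @^-1` [set l | (N k <= l)%N] `&` walk_hits F x y 0 (N k))).
  apply: fin_bigcap_measurable => // x _; apply/measurableC/measurableI.
    exact: measurable_lifetime.
  exact: measurable_walk_hits.
by apply/seteqP; split=> w wK x /wK.
Qed.

Lemma pr_start s : path (@Zd_adj d) 0 s ->
  pr P (start s) = tail_prob (size s).+1 * (2 * d)%:R ^- size s.
Proof.
move=> s0.
have := independent_failure (J := [::]) (K := [fset (0 : Zd d)]%fset)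
  (fun x => @sigma_lifetime x setT) (fun x => @sigma_walk_prefix x s)
  (fun x => @sigma_lifetime x [set l | (size s < l)%N])
  (fun x => @sigma_walk_prefix x s) isT (fun x => _).
rewrite big_nil mulr1 big_seq_fset1 pr_lifetime pr_walk_prefix// => <- //.
by congr (pr P _); apply/seteqP; split=> w //= [].
Qed.

(** The start concerns only the frog of 0 and the failure only the others, so the probabilities
    multiply over the frogs. *)
Lemma pr_start_failure s k y : path (@Zd_adj d) 0 s ->
  pr P (start s `&` failure k y) <= pr P (start s) *
    \prod_(x <- [seq x <- site k | x != 0]) (1 - tail_prob (N k) * hit_prob (N
      k) y x).
Proof.
move=> s0.
have -> := independent_failure (K := [fset (0 : Zd d)]%fset)
  (fun x => @sigma_lifetime x [set l | (N k <= l)%N])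
  (fun x => @sigma_walk_hits x y 0 (N k))
  (fun x => @sigma_lifetime x [set l | (size s < l)%N])
  (fun x => @sigma_walk_prefix x s)
  (filter_uniq _ (site_uniq k)).
  rewrite big_seq_fset1 pr_lifetime pr_walk_prefix// pr_start//.
  rewrite ler_wpM2l ?mulr_ge0 ?invr_ge0 ?tail_prob_ge0//.
  apply: ler_prod => x _; rewrite pr_lifetime -/(tail_prob (N k)).
  have p_le1 := pr_le1 P (measurable_walk_hits F x y 0 (N k)).
  rewrite subr_ge0 mulr_ile1 ?tail_prob_le1 ?tail_prob_ge0 ?pr_ge0//=.
  by rewrite lerD2l lerN2 ler_wpM2l ?tail_prob_ge0// pr_walk_hits.
by move=> x; rewrite mem_filter inE => /andP[].
Qed.

(** Given the start, a union bound over targets and scales applies, and the bounds [C / (k (k + 1))]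
    telescope. *)
Lemma recurrent_criterion (C : R) (K0 : nat) :
  (forall n, 0 < tail_prob n) ->
  (forall k, (K0 <= k)%N -> \sum_(y <- target k)
    \prod_(x <- [seq x <- site k | x != 0])
      (1 - tail_prob (N k) * hit_prob (N k) y x) <= C / (k%:R * k.+1%:R)) ->
  recurrent F.
Proof.
move=> tail_prob_gt0 bound.
(* From this scale on, the telescoped failures take less than half of the probability of the
   start. *)
pose K := maxn K0 (Num.bound (2 * `|C|)).+1.
have K_gt0 : 0 < K%:R :> R by rewrite ltr0n leq_max orbT.
have CK : `|C| / K%:R < 1 / 2.
  have : 2 * `|C| < K%:R.
    apply: lt_le_trans (archi_boundP _) _; first by rewrite mulr_ge0.
    by rewrite ler_nat leq_max leqW ?orbT.
  by rewrite ltr_pdivrMr// => ?; lra.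
have [s s0 sK] := Zd_path_cover 0 (site K).
have [Z [mZ Z0] nnZ] := walk_nearest_neighbour_ae F.
set p := pr P (start s).
have p_gt0 : 0 < p.
  by rewrite /p pr_start// mulr_gt0// invr_gt0 exprn_gt0// ltr0n muln_gt0.
(* The event that the start occurs and some target is missed at scale [K + n]. *)
pose G n : set Omega :=
  \big[setU/set0]_(y <- target (K + n)) (start s `&` failure (K + n) y).
have mGy k y : measurable (start s `&` failure k y).
  by apply: measurableI; [exact: measurable_start|exact: measurable_failure].
have mG n : measurable (G n) by exact: bigsetU_measurable.
have G_le n : pr P (G n) <= p * (`|C| / (K + n)%:R - `|C| / (K + n.+1)%:R).
  apply: (le_trans (pr_bigsetU_le _ _ _)) => //.
  apply: (@le_trans _ _ (p * (C / ((K + n)%:R * (K + n).+1%:R)))).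
    apply: le_trans (ler_wpM2l (ltW p_gt0) (bound (K + n)%N _)); last first.
      by apply: leq_trans (leq_addr _ _); rewrite leq_maxl.
    rewrite mulr_sumr; apply: ler_sum => y _; exact: pr_start_failure.
  rewrite ler_wpM2l ?(ltW p_gt0)//.
  have a_gt0 : 0 < (K + n)%:R :> R by rewrite natrD ltr_pwDl.
  have -> : `|C| / (K + n)%:R - `|C| / (K + n.+1)%:R =
      `|C| / ((K + n)%:R * (K + n).+1%:R).
    by rewrite addnS -natr1; field; rewrite !gt_eqF ?ltr_pwDl.
  by rewrite ler_wpM2r ?ler_norm// invr_ge0 mulr_ge0.
have mUG : measurable (\bigcup_n G n) by exact: bigcupT_measurable.
have UG_le : pr P (\bigcup_n G n) <= p * (`|C| / K%:R).
  rewrite -lee_fin prE//.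
  apply: le_trans (measure_sigma_subadditive P mG mUG _) _ => //.
  have cvgG : cvgn (fun n => \sum_(0 <= k < n) P (G k))%E.
    by apply: is_cvg_nneseries => n _ _; exact: measure_ge0.
  apply: (lime_le cvgG); apply: nearW => n.
  under eq_bigr do rewrite -prE//.
  rewrite sumEFin lee_fin.
  have -> : p * (`|C| / K%:R) = p * (`|C| / (K + 0)%:R) by rewrite addn0.
  apply: (@le_trans _ _ (p * (`|C| / (K + 0)%:R - `|C| / (K + n)%:R))).
    elim: n => [|n IHn]; first by rewrite big_nil subrr mulr0.
    rewrite big_nat_recr//=; apply: le_trans (lerD IHn (G_le n)) _.
    by rewrite -mulrDr addrA subrK.
  by rewrite ler_wpM2l ?(ltW p_gt0)// gerBl divr_ge0.
pose good := start s `\` (\bigcup_n G n `|` Z).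
have mB : measurable (\bigcup_n G n `|` Z) by exact: measurableU.
have mgood : measurable good by apply: measurableD => //;
  exact: measurable_start.
have good_gt0 : 0 < pr P good.
  have : p <= pr P good + (pr P (\bigcup_n G n) + pr P Z).
    apply: le_trans (lerD (lexx _) (pr_setU_le P mUG mZ)).
    apply: le_trans (pr_setU_le P mgood mB).
    apply: pr_le; [exact: measurable_start|exact: measurableU|].
    by move=> w ws; have [wB|wB] := pselect ((\bigcup_n G n `|` Z) w);
      [right|left].
  rewrite (_ : pr P Z = 0); last exact: pr_EFin.
  rewrite addr0 => p_le; have : p * (`|C| / K%:R) < p * (1 / 2).
    by rewrite ltr_pM2l.
  move: p_gt0 p_le UG_le; clear; lra.
rewrite /recurrent.
have mR := measurable_root_hit_infinitely_often F.
apply: (@lt_le_trans _ _ (P good)); first by rewrite -prE// lte_fin.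
apply: le_measure; rewrite ?inE// => w [ws wB].
have nn : nearest_neighbour F w.
  by move=> x n; apply: nnZ => Zw; apply: wB; right.
apply: (@success_root_hit K) => //.
  move=> x /sK xs.
  have [/= s_lt sw] := ws 0 (fset11 _).
  (* The frog of 0 is at [x] at time [i], and [i <= size s] is less than its lifetime. *)
  pose i := index x (0 :: s).
  have i_le : (i <= size s)%N by rewrite -ltnS -[(size s).+1]/(size (0 :: s))
    index_mem.
  have <- : walk F 0 i w = x by rewrite sw// nth_index.
  by apply: activated_visit; [exact: activated0|exact: leq_ltn_trans s_lt].
move=> k Kk y yk; apply: contrapT => no_x; apply: wB; left.
exists (k - K)%N => //; rewrite /G subnKC//.
rewrite -bigcup_seq; exists y => //; split=> // x.
rewrite mem_filter => /andP[x0 xk] [xl xy]; apply: no_x; exists x.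
by split.
Qed.

End Criterion.

Lemma prod_1B_le_expR {R : realType} (I : eqType) (s : seq I) (q : R) (h : I ->
  R) :
  (forall i, i \in s -> 0 <= q * h i <= 1) ->
  \prod_(i <- s) (1 - q * h i) <= expR (- (q * \sum_(i <- s) h i)).
Proof.
move=> qh; rewrite mulr_sumr -sumrN expR_sum [leLHS]big_seq [leRHS]big_seq.
apply: ler_prod => i /qh /andP[_ qh1]; rewrite subr_ge0 qh1 /=.
exact: expR_ge1Dx.
Qed.

(** * From tail bounds to growing boxes *)

Section Recurrence.
Context {R : realType}.
Context {disp0 : measure_display} {Omega0 : measurableType disp0}.
Context {P0 : probability Omega0 R} {Xi : {RV P0 >-> nat}}.
Context {disp : measure_display} {Omega : measurableType disp}.
Context {P : probability Omega R}.

Local Notation tail_prob := (tail_prob (Xi := Xi)).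

Lemma tail_prob_anti m n : (m <= n)%N -> tail_prob n <= tail_prob m.
Proof.
move=> mn; apply: pr_le => [||u /(leq_trans mn)//].
  exact: (measurable_funPTI Xi (Y := [set l | (n <= l)%N])).
exact: (measurable_funPTI Xi (Y := [set l | (m <= l)%N])).
Qed.

Lemma tail_prob_le (r : R) n : (r%:E <= P0 [set w | (n <= Xi w)%N])%E -> r <=
  tail_prob n.
Proof.
rewrite -prE ?lee_fin//.
exact: (measurable_funPTI Xi (Y := [set l | (n <= l)%N])).
Qed.

Lemma tail_prob_gt0 (f : nat -> R) (K0 : nat) :
  (forall n, (K0 <= n)%N -> 0 < f n <= tail_prob (n ^ 2)) -> forall n, 0 <
    tail_prob n.
Proof.
move=> f_tail n; have /andP[f_gt0 f_le] := f_tail (K0 + n)%N (leq_addr _ _).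
apply: lt_le_trans f_gt0 (le_trans f_le _).
apply: tail_prob_anti; nia.
Qed.

(** The growth condition makes each site of [box k.+1] missed with probability at most [e k^(-d-2)].
    There are at most [(5 k)^d] such sites, and [k + 1 <= 2 k] turns the total [e 5^d / k^2] into
    the form of the criterion. *)
Lemma recurrent_of_box_growth (d : nat) (F : frog_model d Xi P) (v : nat -> R)
    (K0 : nat) : (0 < d)%N ->
  (forall n, 0 < tail_prob n) -> (forall k, 0 <= v k) ->
  (forall k (y : Zd d), v k <= 1 - avg (hit_prob (k ^ 2) y) y) ->
  (forall k, (K0 <= k)%N ->
    d.+2%:R * ln k%:R <=
    tail_prob (k ^ 2) * (v k * occupation_cst (R := R) (d := d) * k%:R ^+ 2)) ->
  recurrent F.
Proof.
move=> d_gt0 tail0 v_ge0 v_le growth.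
pose C : R := 2 * expR 1 * 5 ^+ d.
apply: (@recurrent_criterion R d d_gt0 _ _ _ _ _ _ _ F box (fun k => box k.+1)
  (fun k => k ^ 2)%N _ _ _ _ C (maxn K0 (d + 2))) => //.
- by move=> k z zk; right; exists z => // f j _ _ fj; exists j.
- by move=> k; exact: box0.
- by case=> // k; rewrite -mulnn leq_pmulr.
- exact: box_uniq.
move=> k; rewrite geq_max => /andP[K0k dk].
have k_gt0 : (0 < k)%N by lia.
have kR_gt0 : 0 < k%:R :> R by rewrite ltr0n.
have q_ge0 : 0 <= tail_prob (k ^ 2) by exact/ltW/tail0.
have q_le1 : tail_prob (k ^ 2) <= 1 by exact: tail_prob_le1.
apply: (@le_trans _ _ (\sum_(y <- (box k.+1 : seq (Zd d)))
   expR 1 * k%:R ^- d.+2)).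
  rewrite big_seq [leRHS]big_seq; apply: ler_sum => y yk.
  apply: le_trans (prod_1B_le_expR _) _ => [x _|].
    by rewrite mulr_ge0 ?hit_prob_ge0//= mulr_ile1 ?hit_prob_ge0 ?hit_prob_le1.
  rewrite -[k%:R in leRHS]lnK ?posrE// -expRM_natl -expRN -expRD ler_expR.
  have := sum_hit_prob_ge d_gt0 dk yk (v_ge0 k) (v_le k y).
  rewrite (bigID (fun x => x != 0)) /= big_filter => sum_ge.
  (* Leaving out the frog of 0 costs at most 1 in the exponent, hence the factor [expR 1]. *)
  have zero_le1 : \sum_(x <- (box k : seq (Zd d)) | ~~ (x != 0)) hit_prob (k ^
    2) y x <= 1 :> R.
    rewrite (eq_bigl (fun x => x == 0)) => [|x]; last by rewrite negbK.
    rewrite big_mkcond (bigD1_seq 0) ?box0 ?box_uniq//= eqxx.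
    by rewrite big1 ?addr0 ?hit_prob_le1// => x /negPf ->.
  have := growth k K0k.
  set S := \sum_(x <- _ | x != 0) _ in sum_ge *.
  move: (\sum_(x <- _ | ~~ _) _) zero_le1 sum_ge => T T1.
  move: (v k * _ * _) => V VST grow.
  have : tail_prob (k ^ 2) * V <= tail_prob (k ^ 2) * (S + T) by rewrite
    ler_wpM2l.
  have : tail_prob (k ^ 2) * T <= 1.
    by apply: le_trans q_le1; rewrite ler_piMr.
  by move: grow; lra.
rewrite big_const_seq count_predT size_box iter_addr_0 -[_ *+ (_ ^ d)]mulr_natl.
rewrite natrX.
have le5 : (2 * k.+1).+1%:R ^+ d <= 5 ^+ d * k%:R ^+ d :> R.
  rewrite -exprMn lerXn2r ?nnegrE ?mulr_ge0// -natrM ler_nat; lia.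
apply: (@le_trans _ _ (5 ^+ d * k%:R ^+ d * (expR 1 * k%:R ^- d.+2))).
  by rewrite ler_wpM2r// mulr_ge0 ?expR_ge0// invr_ge0 exprn_ge0// ltW.
have -> : 5 ^+ d * k%:R ^+ d * (expR 1 * k%:R ^- d.+2) =
    expR 1 * 5 ^+ d / k%:R ^+ 2 :> R.
  rewrite -[d.+2]addn2 exprD invfM; field.
  by rewrite expf_neq0 ?gt_eqF.
have -> : C / (k%:R * k.+1%:R) = expR 1 * 5 ^+ d * (2 / (k%:R * k.+1%:R)).
  by rewrite /C; ring.
rewrite ler_wpM2l ?mulr_ge0 ?expR_ge0 ?exprn_ge0//.
rewrite ler_pdivlMr ?mulr_gt0// mulrC ler_pdivrMr ?exprn_gt0//.
by rewrite -natrM -natrX -natrM ler_nat; nia.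
Qed.

End Recurrence.

(** * Recurrence in each dimension *)

Lemma recurrent_ge3 {R : realType} (d : nat) : (3 <= d)%N ->
  exists2 beta : R, 0 < beta &
  forall (disp0 : measure_display) (Omega0 : measurableType disp0)
    (P0 : probability Omega0 R) (Xi : {RV P0 >-> nat})
    (disp : measure_display) (Omega : measurableType disp)
    (P : probability Omega R) (F : frog_model d Xi P) (n0 : nat),
  (forall n, (n0 <= n)%N ->
    beta * n%:R ^- 2 * ln n%:R <= tail_prob (Xi := Xi) (n ^ 2)) -> recurrent F.
Proof.
move=> d_ge3; have d_gt0 : (0 < d)%N by lia.
have [v /andP[v_gt0 _] v_le] := @escape_prob_ge3 R d d_ge3.
have c_gt0 := @occupation_cst_gt0 R d d_gt0; set c := occupation_cst in c_gt0.
have beta_gt0 : 0 < d.+2%:R / (v * c) by rewrite divr_gt0// mulr_gt0.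
exists (d.+2%:R / (v * c)) => // disp0 O0 P0 Xi disp O P F n0 tail_ge.
(* Starting at [n0.+2] makes [ln n] positive. The constant [beta] turns the growth condition into an
   equality at the assumed tail bound. *)
apply: (@recurrent_of_box_growth _ _ _ _ _ _ _ _ d F (fun=> v) n0.+2) => //.
- apply: (tail_prob_gt0 (f := fun n => d.+2%:R / (v * c) * n%:R ^- 2 * ln n%:R)
    (K0 := n0.+2)) => n n_ge.
  rewrite tail_ge ?andbT; last by lia.
  have n_gt0 : 0 < n%:R :> R by rewrite ltr0n; lia.
  have lnn_gt0 : 0 < ln n%:R :> R by rewrite ln_gt0// ltr1n; lia.
  by rewrite mulr_gt0 ?exprn_gt0// mulr_gt0// invr_gt0 exprn_gt0.
- by move=> _; exact: ltW.
move=> k k_ge; have kn0 : (n0 <= k)%N by lia.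
have k_gt0 : 0 < k%:R :> R by rewrite ltr0n; lia.
apply: (@le_trans _ _ (d.+2%:R / (v * c) * k%:R ^- 2 * ln k%:R * (v * c * k%:R
  ^+ 2))).
  rewrite le_eqVlt; apply/orP; left; apply/eqP; field.
  by rewrite !gt_eqF.
apply: ler_wpM2r; last exact: tail_ge.
by apply/ltW; rewrite mulr_gt0 ?exprn_gt0// mulr_gt0.
Qed.

Lemma recurrent_2 {R : realType} : exists2 beta : R, 0 < beta &
  forall (disp0 : measure_display) (Omega0 : measurableType disp0)
    (P0 : probability Omega0 R) (Xi : {RV P0 >-> nat})
    (disp : measure_display) (Omega : measurableType disp)
    (P : probability Omega R) (F : frog_model 2 Xi P) (n0 : nat),
  (forall n, (n0 <= n)%N ->
    beta * n%:R ^- 2 * ln n%:R ^+ 2 <= tail_prob (Xi := Xi) (n ^ 2)) ->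
      recurrent F.
Proof.
have c_gt0 := @occupation_cst_gt0 R 2 isT; set c := occupation_cst in c_gt0.
have ln2_gt0 : 0 < ln 2 :> R by rewrite ln_gt0// ltr1n.
have beta_gt0 : 0 < 24 / (ln 2 * c) by rewrite divr_gt0// mulr_gt0.
(* Here 24 = 4 * 6: 4 is [d.+2] and 6 comes from the bound on [L k] by [6 ln k]. *)
exists (24 / (ln 2 * c)) => // disp0 O0 P0 Xi disp O P F n0 tail_ge.
pose L k : R := ln (1 + 2 * (k ^ 2).+1%:R ^+ 2).
have L_gt0 k : 0 < L k by rewrite ln_gt0// ltrDl mulr_gt0// exprn_gt0.
apply: (@recurrent_of_box_growth _ _ _ _ _ _ _ _ 2 F (fun k => ln 2 / L k)
  n0.+2) => //.
- apply: (tail_prob_gt0 (f := fun n => 24 / (ln 2 * c) * n%:R ^- 2 * ln n%:R ^+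
  2)
    (K0 := n0.+2)) => n n_ge.
  rewrite tail_ge ?andbT; last by lia.
  have n_gt0 : 0 < n%:R :> R by rewrite ltr0n; lia.
  have lnn_gt0 : 0 < ln n%:R :> R by rewrite ln_gt0// ltr1n; lia.
  by rewrite mulr_gt0 ?exprn_gt0// mulr_gt0// invr_gt0 exprn_gt0.
- by move=> k; rewrite divr_ge0// ltW.
- by move=> k y; exact: escape_prob_ge2.
move=> k k_ge; have kn0 : (n0 <= k)%N by lia.
have k_gt0 : 0 < k%:R :> R by rewrite ltr0n; lia.
have lnk_gt0 : 0 < ln k%:R :> R by rewrite ln_gt0// ltr1n; lia.
(* This amounts to [1 + 2 (a + 1)^2 <= a^3] for [a = k^2 >= 4]. *)
have L_le : L k <= 6 * ln k%:R.
  rewrite mulr_natl -lnXn// ler_ln ?posrE ?exprn_gt0//.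
  rewrite -!natrX -natrM -[1]/(1%:R) -natrD ler_nat.
  have : (4 <= k ^ 2)%N by rewrite -[4%N]/(2 ^ 2)%N leq_exp2r//; lia.
  rewrite -[6%N]/(2 * 3)%N expnM; move: (k ^ 2)%N => a a4.
  by rewrite !expnS expn0 muln1; nia.
apply: (@le_trans _ _ (24 / (ln 2 * c) * k%:R ^- 2 * ln k%:R ^+ 2 *
    (ln 2 / L k * c * k%:R ^+ 2))); last first.
  apply: ler_wpM2r; last exact: tail_ge.
  by apply/ltW; rewrite mulr_gt0 ?exprn_gt0// mulr_gt0// divr_gt0.
have -> : 24 / (ln 2 * c) * k%:R ^- 2 * ln k%:R ^+ 2 *
    (ln 2 / L k * c * k%:R ^+ 2) = 24 * ln k%:R ^+ 2 / L k.
  by field; rewrite !gt_eqF.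
rewrite ler_pdivlMr//.
have := ler_wpM2l (ltW lnk_gt0) L_le; lra.
Qed.

Lemma discrete_ivt (f : nat -> int) (a : int) (j : nat) :
  (forall i, `|(f i - f i.+1)%R| <= 1)%N -> f 0%N <= a <= f j ->
  exists2 i, (i <= j)%N & f i = a.
Proof.
move=> f_step; elim: j => [|j IHj] /andP[a0 aj].
  by exists 0%N => //; lia.
have [aj'|aj'] := leP a (f j).
  have [|i ij fi] := IHj; first by rewrite a0.
  by exists i => //; exact: leqW.
exists j.+1 => //.
have := f_step j; move: aj aj'; move: (f j) (f j.+1) => x y; lia.
Qed.

Lemma Zd1_adj (x y : Zd 1) : Zd_adj x y -> (`|(x ord0 ord0 - y ord0 ord0)%R| <=
  1)%N.
Proof. by rewrite /Zd_adj big_ord_recl big_ord0 addn0 => /eqP ->. Qed.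

Lemma recurrent_1 {R : realType} : exists2 beta : R, 0 < beta &
  forall (disp0 : measure_display) (Omega0 : measurableType disp0)
    (P0 : probability Omega0 R) (Xi : {RV P0 >-> nat})
    (disp : measure_display) (Omega : measurableType disp)
    (P : probability Omega R) (F : frog_model 1 Xi P) (n0 : nat),
  (forall n, (n0 <= n)%N ->
    beta * n%:R^-1 * ln (ln n%:R) <= tail_prob (Xi := Xi) (n ^ 2)) -> recurrent
      F.
Proof.
have ln2_gt0 : 0 < ln 2 :> R by rewrite ln_gt0// ltr1n.
have [c c_gt0 hit_ge] : exists2 c : R, 0 < c & forall L N (x y : Zd 1),
    (0 < N)%N -> (2 * L ^ 2 <= N)%N ->
    (`|(x ord0 ord0 - y ord0 ord0)%R| <= L)%N -> c <= hit_prob N.+1 y x.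
  exists (8 / 169); first lra.
  by move=> L N x y; exact: hit_prob1_near.
have beta_gt0 : 0 < 5 / c by rewrite divr_gt0.
(* At scale [n = 2^k] with lifetimes [(5 n)^2], the [2 n] frogs of the box other than that of 0
   produce the exponent [2 n c] times the tail, which is at least [2 ln (ln (5 n))]. *)
exists (5 / c) => // disp0 O0 P0 Xi disp O P F n0 tail_ge.
pose pt (a : int) : Zd 1 := \row__ a.
pose target k := [:: 0; pt (2 ^ k.+1)%N%:Z; pt (- (2 ^ k.+1)%N%:Z)].
have tail0 n : 0 < tail_prob (Xi := Xi) n.
  (* Beyond [e], the iterated logarithm is positive. *)
  apply: (tail_prob_gt0 (f := fun n => 5 / c * n%:R^-1 * ln (ln n%:R))
    (K0 := (n0 + (Num.bound (expR 1 : R)).+1)%N)) => {}n n_ge.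
  rewrite tail_ge ?andbT; last by lia.
  have e_lt : expR 1 < n%:R :> R.
    apply: lt_le_trans (archi_boundP (expR_ge0 1)) _.
    by rewrite ler_nat; lia.
  have n_gt0 : 0 < n%:R :> R by apply: lt_trans e_lt; exact: expR_gt0.
  rewrite mulr_gt0 ?divr_gt0// ln_gt0//.
  by rewrite -ltr_expR lnK.
apply: (@recurrent_criterion R 1 isT _ _ _ _ _ _ _ F (fun k => box (2 ^ k)%N)
  target (fun k => (5 * 2 ^ k) ^ 2)%N _ _ _ _ (6 / ln 2 ^+ 2) n0.+1) => //.
- move=> k z; rewrite !mem_box => /forallP zk1.
  have [zk|zk] := boolP [forall i, (`|z ord0 i| <= 2 ^ k)%N]; [by left|right].
  have {}zk : (2 ^ k < `|z ord0 ord0|)%N.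
    move: zk; rewrite negb_forall => /existsP[i]; rewrite (ord1 i).
    by rewrite -ltnNge.
  have z_eq (y : Zd 1) : y ord0 ord0 = z ord0 ord0 -> y = z.
    by move=> yz; apply: Zd_ext => i; rewrite (ord1 i).
  have zk1' := zk1 ord0.
  have [z_ge0|z_lt0] := leP 0 (z ord0 ord0).
    exists (pt (2 ^ k.+1)%N%:Z); first by rewrite !inE eqxx orbT.
    move=> f j; rewrite mem_box => /forallP/(_ ord0) f0 fnn fj.
    have [|/=|i ij fi] := discrete_ivt (f := fun i => f i ord0 ord0)
        (a := z ord0 ord0) (j := j).
    + by move=> i; exact/Zd1_adj/fnn.
    + rewrite fj mxE; move: (f 0%N _ _) (z _ _) f0 zk zk1' z_ge0 => a b; lia.
    + by exists i => //; exact: z_eq.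
  exists (pt (- (2 ^ k.+1)%N%:Z)); first by rewrite !inE eqxx !orbT.
  move=> f j; rewrite mem_box => /forallP/(_ ord0) f0 fnn fj.
  have [|/=|i ij fi] := discrete_ivt (f := fun i => - f i ord0 ord0)
      (a := - z ord0 ord0) (j := j).
  + move=> i; have := Zd1_adj (fnn i); move: (f i _ _) (f i.+1 _ _) => a b; lia.
  + rewrite fj mxE; move: (f 0%N _ _) (z _ _) f0 zk zk1' z_lt0 => a b; lia.
  + by exists i => //; apply: z_eq; exact: oppr_inj.
- by move=> k; rewrite mem_head.
- move=> k; have : (k <= 2 ^ k)%N by exact/ltnW/ltn_expl.
  nia.
- by move=> k; exact: box_uniq.
move=> k k_ge; set n := (2 ^ k)%N.
have n_gt0 : (0 < n)%N by rewrite expn_gt0.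
have nR_gt0 : 0 < n%:R :> R by rewrite ltr0n.
set q := tail_prob _.
have lnk_gt0 : 0 < k%:R * ln 2 :> R by rewrite mulr_gt0// ltr0n; lia.
have lnn : k%:R * ln 2 <= ln (5 * n)%:R :> R.
  rewrite mulr_natl -lnXn// -natrX ler_ln ?posrE ?ltr0n ?muln_gt0 ?n_gt0//.
  by rewrite ler_nat leq_pmull.
have prod_le y : y \in target k ->
    \prod_(x <- [seq x <- box n | x != 0]) (1 - q * hit_prob ((5 * n) ^ 2) y x)
    <= (k%:R * ln 2) ^- 2 :> R.
  move=> yk; apply: le_trans (prod_1B_le_expR _) _ => [x _|].
    by rewrite mulr_ge0 ?hit_prob_ge0 ?(ltW (tail0 _))//= mulr_ile1
      ?hit_prob_ge0 ?hit_prob_le1 ?(ltW (tail0 _)) ?tail_prob_le1.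
  rewrite -[in leRHS](lnK lnk_gt0) -expRM_natl -expRN ler_expR lerN2.
  apply: (@le_trans _ _ (q * \sum_(x <- [seq x <- box n | x != 0 :> Zd 1]) c)).
    rewrite big_const_seq count_predT iter_addr_0.
    have -> : size [seq x <- box n | x != 0 :> Zd 1] = (2 * n)%N.
      rewrite size_filter; have := count_predC (pred1 (0 : Zd 1)) (box n).
      rewrite size_box expn1 (count_uniq_mem _ (box_uniq _)) box0.
      rewrite add1n => -[<-].
      by apply: eq_count.
    rewrite -[_ *+ (2 * n)]mulr_natl.
    have n0k : (n0 <= 5 * n)%N.
      have : (k < n)%N by exact: ltn_expl.
      lia.
    apply: (@le_trans _ _ (5 / c * (5 * n)%:R^-1 * ln (ln (5 * n)%:R) *
        ((2 * n)%:R * c))).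
      have -> : 5 / c * (5 * n)%:R^-1 * ln (ln (5 * n)%:R) * ((2 * n)%:R * c)
          = 2 * ln (ln (5 * n)%:R) :> R.
        by rewrite !natrM; field; rewrite !gt_eqF.
      rewrite ler_wpM2l// ler_ln ?posrE//.
      exact: lt_le_trans lnn.
    apply: ler_wpM2r; last exact: tail_ge.
    by apply: mulr_ge0 => //; exact: ltW.
  rewrite ler_wpM2l ?(ltW (tail0 _))// big_seq [leRHS]big_seq.
  apply: ler_sum => x; rewrite mem_filter => /andP[_].
  rewrite mem_box => /forallP/(_ ord0) xn.
  have -> : ((5 * n) ^ 2 = ((5 * n) ^ 2).-1.+1)%N.
    by rewrite prednK// expn_gt0 muln_gt0 n_gt0.
  (* The targets are 0 and [2 n], [-2 n], within [3 n] of the box; and [2 (3 n)^2 = 18 n^2] is at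
     most [25 n^2 - 1], where the 1 matches the horizon [N.+1]. *)
  apply: (hit_ge (3 * n)%N) => //.
  - by rewrite -subn1 subn_gt0; nia.
  - by rewrite -subn1; nia.
  - move: yk; rewrite !inE => /or3P[]/eqP ->; rewrite mxE.
    + by move: (x _ _) xn => a; lia.
    + by move: (x _ _) xn; rewrite expnS -/n => a; lia.
    + by move: (x _ _) xn; rewrite expnS -/n => a; lia.
rewrite /target !big_cons big_nil addr0.
have p1 := prod_le 0 (mem_head _ _).
have t2 : pt (2 ^ k.+1)%N%:Z \in target k by rewrite !inE eqxx orbT.
have t3 : pt (- (2 ^ k.+1)%N%:Z) \in target k by rewrite !inE eqxx !orbT.
have p2 := prod_le _ t2; have p3 := prod_le _ t3.
(* Three targets, and [k + 1 <= 2 k]: hence the constant 6. *)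
apply: (@le_trans _ _ (3 * (k%:R * ln 2) ^- 2)).
  by move: p1 p2 p3; lra.
have -> : 6 / ln 2 ^+ 2 / (k%:R * k.+1%:R) =
    6 / (k%:R * k.+1%:R) * (ln 2 ^+ 2)^-1 :> R by ring.
rewrite exprMn invfM mulrA ler_wpM2r ?invr_ge0 ?sqr_ge0//.
have k_gt0 : 0 < k%:R :> R by rewrite ltr0n (leq_ltn_trans _ k_ge).
rewrite ler_pdivlMr ?mulr_gt0// mulrAC ler_pdivrMr ?exprn_gt0//.
by rewrite -natrM -natrX -!natrM ler_nat; clear -k_ge; nia.
Qed.

Theorem theorem1p14 (R : realType) :
  exists beta : nat -> R,
    (forall d : nat, 0 < beta d) /\
    forall (d : nat) (disp0 : measure_display) (Omega0 : measurableType disp0)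
      (P0 : probability Omega0 R) (Xi : {RV P0 >-> nat}),
      (1 <= d)%N ->
      (\forall n \near \oo,
        let tail := P0 [set w | (n ^ 2 <= Xi w)%N] in
        [\/ d = 1%N /\
              ((beta 1%N * n%:R^-1 * ln (ln n%:R))%:E <= tail)%E,
            d = 2%N /\
              ((beta 2%N * n%:R ^- 2 * ln n%:R ^+ 2)%:E <= tail)%E
          | (3 <= d)%N /\
              ((beta d * n%:R ^- 2 * ln n%:R)%:E <= tail)%E]) ->
      forall (disp : measure_display) (Omega : measurableType disp)
        (P : probability Omega R) (F : frog_model d Xi P),
        recurrent F.
Proof.
have [beta1 beta1_gt0 rec1] := @recurrent_1 R.
have [beta2 beta2_gt0 rec2] := @recurrent_2 R.
(* The constants must be fixed before [Xi]; for [d >= 3] one is chosen for each [d], and 1 is a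
   default value at [d = 0]. *)
pose beta d := match d return R with
  | 0 => 1 | 1 => beta1 | 2 => beta2
  | d'.+3 => sval (cid2 (@recurrent_ge3 R d'.+3 isT))
  end.
exists beta; split.
  by case=> [|[|[|d]]] //=; case: cid2.
case=> [|[|[|d]]] //= disp0 Omega0 P0 Xi _ [n0 _ tail_ge] disp Omega P F.
- apply: (rec1 _ _ _ _ _ _ _ F n0) => n n0n; apply: tail_prob_le.
  by case: (tail_ge n n0n) => -[].
- apply: (rec2 _ _ _ _ _ _ _ F n0) => n n0n; apply: tail_prob_le.
  by case: (tail_ge n n0n) => -[].
- move: tail_ge; case: cid2 => b b_gt0 rec3 tail_ge.
  apply: (rec3 _ _ _ _ _ _ _ F n0) => n n0n; apply: tail_prob_le.
  by case: (tail_ge n n0n) => -[].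
Qed.
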